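(* Let $\Gamma$ be a simplicial complex on the vertex set $[n]$, and let $\Delta(\Gamma)$ be its symmetric algebraic shifting and $b_{i,r}(\Gamma)$ its symmetric iterated Betti numbers (see context). Then for all $0\le i,r\le n$, \[ b_{i,r}(\Gamma)=\begin{cases} \big|\{F\in \max(\Delta(\Gamma)) : |F|=i,\ [i-r]\subseteq F,\ i-r+1\notin F\}\big| & \text{if } r\le i,\\ 0 & \text{otherwise,}\end{cases} \] where $\max(\Delta(\Gamma))$ is the set of facets (maximal faces) of $\Delta(\Gamma)$.
   Context: Let $\mathbf{k}$ be a field of characteristic zero, $S=\mathbf{k}[y_1,\dots,y_n]$ with the standard grading, and $\mathbf{m}=\langle y_1,\dots,y_n\rangle$. Write $[a,b]=\{a,\dots,b\}$, $[i]=\{1,\dots,i\}$, $[0]=\emptyset$. Let $\succ$ be the degree reverse lexicographic order on monomials with $y_n\succ y_{n-1}\succ\cdots\succ y_1$. For a homogeneous ideal $I\subset S$ there is a nonempty Zariski open set $U(I)\subset GL(S_1)$ such that the initial ideal $\mathrm{in}_\succ(uI)$ is the same for all $u\in U(I)$; it is the generic initial ideal $\mathrm{Gin}(I)$. Fix $u\in U(I)$. Let $B(I)$ be the set of monomials of $S$ not in $\mathrm{Gin}(I)$. Define $J_0(I)=uI$ and $J_i(I)=y_iS+(J_{i-1}(I):\mathbf{m}^\infty)$ for $1\le i\le n$. For a graded $S$-module $M$, $H^0(M)=\{x\in M: \mathbf{m}^kx=0 \text{ for some }k\}$, and $H^0(M)_r$ is its degree-$r$ component. The symmetric iterated Betti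 numbers of $I$ are $b_{i,r}(I)=\dim_{\mathbf{k}} H^0(S/J_i(I))_r$ for $0\le i,r\le n$. For a simplicial complex $\Gamma$ on $[n]$, the Stanley–Reisner ideal is $I_\Gamma=\langle \prod_{a\in F}y_a : F\subseteq[n],\ F\notin\Gamma\rangle$, and $b_{i,r}(\Gamma):=b_{i,r}(I_\Gamma)$. For a monomial $m=y_{i_1}y_{i_2}\cdots y_{i_r}$ with $i_1\ge i_2\ge\cdots\ge i_r$, set $\Phi(m)=y_{i_1}y_{i_2-1}y_{i_3-2}\cdots y_{i_r-r+1}$ (a squarefree monomial in variables $y_j$, $j\in\mathbb{Z}$), and let $\mathrm{supp}$ of a squarefree monomial be the set of indices of the variables dividing it. The symmetric algebraic shifting of $\Gamma$ is the simplicial complex $\Delta(\Gamma)=\{\mathrm{supp}(\Phi(m)) : m\in B(I_\Gamma),\ \text{all indices occurring in }\Phi(m)\text{ are}\ \ge 1\}$ on $[n]$. *)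

(* Defs.v *)
From HB Require Import structures.
From mathcomp Require Import all_boot all_order all_algebra.
From mathcomp Require Import boolp.
From mathcomp Require Import mpoly.

Set Implicit Arguments.
Unset Strict Implicit.
Unset Printing Implicit Defensive.

Import GRing.Theory.
Local Open Scope ring_scope.

(* Indices are shifted by one: the ordinal j : 'I_n stands for the vertex j + 1
   of [n], and 'X_j for the variable y_{j+1}.  Ideals, and more generally
   subsets of the polynomial ring, are Prop-valued predicates. *)

Section Ideals.

Variables (k : fieldType) (n : nat).
Local Notation S := {mpoly k[n]}.
Implicit Types (I J G : S -> Prop).

Definition ideal_gen G : S -> Prop := fun f =>
  exists s : seq (S * S),
    (forall x, x \in s -> G x.2) /\ f = \sum_(x <- s) x.1 * x.2.

Definition maxideal : S -> Prop := ideal_gen (fun f => exists j : 'I_n, f = 'X_j).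

Definition ideal_exp I (e : nat) : S -> Prop :=
  ideal_gen (fun f => exists t : 'I_e -> S,
    (forall a, I (t a)) /\ f = \prod_(a < e) t a).

(* J : m^oo.  A class f + J of S / J is killed by m^e iff m^e f is contained in
   J, so this is also the set of representatives of H^0(S / J). *)
Definition saturation J : S -> Prop := fun f =>
  exists e, forall g, ideal_exp maxideal e g -> J (g * f).

(* y_{j+1}; only used for j < n *)
Definition yvar (j : nat) : S := if insub j is Some i then 'X_(i : 'I_n) else 0.

Definition principal_add (a : S) J : S -> Prop := fun f =>
  exists g h, J h /\ f = a * g + h.

(* The degree reverse lexicographic order with y_n > ... > y_1: y_1 is the
   smallest variable, so ties in degree are broken at the least index where the
   exponents differ, the larger exponent giving the smaller monomial.  (The
   order that mpoly.v puts on 'X_{1..n} is a degree lexicographic one.) *)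
Definition drl_lt (m1 m2 : 'X_{1..n}) : bool :=
  (mdeg m1 < mdeg m2)%N ||
  (mdeg m1 == mdeg m2) &&
    [exists j : 'I_n, (m2 j < m1 j)%N &&
       [forall l : 'I_n, (l < j)%N ==> (m1 l == m2 l)]].

Definition leading_monomial (f : S) (m : 'X_{1..n}) : Prop :=
  m \in msupp f /\ forall m', m' \in msupp f -> m' = m \/ drl_lt m' m.

Definition initial_ideal I : S -> Prop :=
  ideal_gen (fun g => exists f m, [/\ I f, leading_monomial f m & g = 'X_[m]]).

(* u in GL(S_1), given by its matrix in the basis y_1, ..., y_n, acts on S by
   the algebra map that extends it. *)
Definition lin_subst (u : 'M[k]_n) (f : S) : S :=
  f \mPo [tuple \sum_(i < n) u i j *: 'X_i | j < n].

Definition ideal_image (u : 'M[k]_n) I : S -> Prop := fun g =>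
  exists f, I f /\ g = lin_subst u f.

(* Open subsets of GL_n are the unions of loci {p <> 0} inside GL_n; the
   polynomials p are in the n * n matrix entries. *)
Definition zariski_open_GL (U : 'M[k]_n -> Prop) : Prop :=
  exists P : {mpoly k[n * n]} -> Prop, forall u,
    U u <-> u \in unitmx /\
            exists p, P p /\ p.@[fun c => mxvec u 0 c] <> 0.

(* U is a possible choice of the set U(I). *)
Definition generic_locus I (U : 'M[k]_n -> Prop) : Prop :=
  [/\ zariski_open_GL U, exists u, U u &
      forall u v, U u -> U v -> forall f,
        initial_ideal (ideal_image u I) f <-> initial_ideal (ideal_image v I) f].

(* The common value of in(uI) for u in U(I).  It does not depend on the choice
   of U(I), since over an infinite field nonempty open subsets of GL_n meet. *)
Definition Gin I : S -> Prop := fun f =>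
  exists U, generic_locus I U /\
    forall u, U u -> initial_ideal (ideal_image u I) f.

Definition Bset I (m : 'X_{1..n}) : Prop := ~ Gin I 'X_[m].

Fixpoint Jideal I (u : 'M[k]_n) (i : nat) : S -> Prop :=
  if i is j.+1 then principal_add (yvar j) (saturation (Jideal I u j))
  else ideal_image u I.

(* dim_k of the image of the subspace A in S / J is d: the classes of some
   e_1, ..., e_d in A form a basis of this image. *)
Definition quot_dim (A J : S -> Prop) (d : nat) : Prop :=
  exists e : 'I_d -> S,
    [/\ forall a, A (e a),
        forall c : 'I_d -> k, J (\sum_a c a *: e a) -> forall a, c a = 0
      & forall f, A f -> exists c : 'I_d -> k, J (f - \sum_a c a *: e a)].

(* b_{i,r}(I) = dim_k H^0(S / J_i(I))_r equals d; J_i(I) is computed from u. *)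
Definition is_iterated_betti I (u : 'M[k]_n) (i r d : nat) : Prop :=
  quot_dim (fun f => f \is r.-homog /\ saturation (Jideal I u i) f)
           (Jideal I u i) d.

End Ideals.

Section Complexes.

Variable n : nat.
Implicit Types (Gamma D : {set {set 'I_n}}) (F G : {set 'I_n}).

Definition simplicial_complex Gamma : Prop :=
  forall F G, F \in Gamma -> G \subset F -> G \in Gamma.

Definition facets D : {set {set 'I_n}} := [set F | maxset (fun G => G \in D) F].

Definition stanley_reisner (k : fieldType) Gamma : {mpoly k[n]} -> Prop :=
  ideal_gen (fun f => exists F, F \notin Gamma /\ f = \prod_(a in F) 'X_a).

Arguments stanley_reisner k Gamma : clear implicits.

(* The sequence i_1 >= ... >= i_r of (1-based) indices such that
   m = y_{i_1} ... y_{i_r}. *)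
Definition mindices (m : 'X_{1..n}) : seq nat :=
  flatten [seq nseq (m j) j.+1 | j <- rev (enum 'I_n)].

(* The squarefree monomial Phi(m), as the list i_1, i_2 - 1, ..., i_r - r + 1
   of the indices of its variables. *)
Definition Phi (m : 'X_{1..n}) : seq int :=
  [seq (nth 0%N (mindices m) a)%:Z - a%:Z | a <- iota 0 (size (mindices m))].

Definition Phi_supp (m : 'X_{1..n}) : {set 'I_n} :=
  [set j : 'I_n | (j.+1)%:Z \in Phi m].

Definition symmetric_shifting (k : fieldType) Gamma : {set {set 'I_n}} :=
  [set F | `[< exists m, [/\ Bset (stanley_reisner k Gamma) m,
                             forall z, z \in Phi m -> 1 <= z
                           & F = Phi_supp m] >]].

End Complexes.

Arguments stanley_reisner {n} k Gamma _.

(* Main.v *)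
(* Let G be the set of leading monomials of uI.  In the reverse lexicographic
   order, adding y_{i+1} and taking colons by powers of y_{i+1} commute with
   passing to leading monomials once y_1, ..., y_i are in the ideal, so the
   leading monomials of the J_i and of their saturations can be read off from G,
   provided that H^0(S / J_i) is the y_{i+1}-torsion.  This and the stabilisation
   needed later follow from one property of G: if m involves only y_j, ..., y_n,
   deg m >= j and m y_j is in G, then m is in G.  It says that for generic linear
   forms theta_1, ..., theta_j, the multiplication by theta_j on
   k[Gamma] / (theta_1, ..., theta_{j-1}) is injective in degrees >= j, and this
   comes from the vanishing of the Koszul homology H_1(theta_1, ..., theta_j; k[Gamma])
   on cycles of degree >= j: filtering k[Gamma] by faces reduces it to a
   polynomial ring, where the Euler field gives a contracting homotopy in
   characteristic zero.
   Thus b_{i,r} counts the monomials m of degree r in y_{i+1}, ..., y_n with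
   m y_i^(i-r) outside G and m y_{i+1}^(i-r+1) in G; under Phi the former
   condition says that a set F containing [i-r] but not i-r+1 is a face of Delta,
   the latter that F together with i-r+1 is not.  As G is strongly stable
   (degenerate uI to its initial ideal and move along an elementary matrix),
   Delta is shifted, so the latter means that F is a facet. *)
Require Import Defs.
From HB Require Import structures.
From mathcomp Require Import all_boot all_order all_algebra.
From mathcomp Require Import boolp.
From mathcomp Require Import mpoly.
From mathcomp Require Import zify ring.

Set Implicit Arguments.
Unset Strict Implicit.
Unset Printing Implicit Defensive.

Import GRing.Theory.
Local Open Scope ring_scope.

(** The set [G] of leading monomials is the same for all matrices in [U], so the kernel bound may be
    checked at one well-chosen matrix: one whose inverse has nonzero minors on all faces. A line
    joining [u] to the inverse of a Vandermonde matrix supplies it. On a face [F] the first [j]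
    forms are then either independent ([j <= #|F|]) or span all linear forms in the variables of
    [F]. In the first case every Koszul 1-cycle is a boundary; in the second only those of positive
    degree are, because dependent forms have constant syzygies. The facet step divides a cycle by
    the squarefree monomial of [F] and lowers its degree by [#|F| < j]: this is the origin of the
    bound deg >= [j]. Besides Euler's formula, characteristic zero provides an infinite field and,
    in the degeneration, makes the coefficient [m i] of the shifted monomial nonzero. *)

Section RevLex.

Variable n : nat.
Implicit Types (m a : 'X_{1..n}) (v : 'I_n).

(** The exponents read as digits in base [b], that of y_1 being the most significant. In degree d
    with b = d + 1 a larger weight means a smaller monomial, so the order becomes numerical; the
    same weights are the exponents of the torus in the degeneration below. *)
Definition drl_weight (b : nat) m : nat := (\sum_(l < n) m l * b ^ (n - l.+1))%N.

Lemma drl_ltP m1 m2 :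
  reflect ((mdeg m1 < mdeg m2)%N \/ mdeg m1 = mdeg m2 /\
             exists v, (m2 v < m1 v)%N /\
               forall l : 'I_n, (l < v)%N -> m1 l = m2 l)
          (drl_lt m1 m2).
Proof.
apply: (iffP orP) => -[H|]; [by left| | by left |].
- case/andP=> /eqP E /existsP[j /andP[lt_j /forallP H]]; right; split=> //.
  by exists j; split=> // l lj; apply/eqP; move/implyP: (H l); apply.
- case=> E [j [lt_j H]]; right; rewrite E eqxx /=.
  apply/existsP; exists j; rewrite lt_j /=.
  by apply/forallP => l; apply/implyP => /H ->.
Qed.

Lemma drl_weight_lt m1 m2 (d : nat) : mdeg m1 = d -> mdeg m2 = d ->
  drl_lt m1 m2 -> (drl_weight d.+1 m2 < drl_weight d.+1 m1)%N.
Proof.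
move=> d1 d2 /drl_ltP [|[_ [v [lt_v eq_l]]]]; first by rewrite d1 d2 ltnn.
rewrite /drl_weight (bigID (fun l : 'I_n => (l < v)%N)) /=.
rewrite [ltnRHS](bigID (fun l : 'I_n => (l < v)%N)) /=.
rewrite [X in (X + _ < _)%N](eq_bigr (fun l => m1 l * d.+1 ^ (n - l.+1))%N); last first.
  by move=> l lv; rewrite eq_l.
rewrite ltn_add2l (bigD1 v) /= ?ltnn // [ltnRHS](bigD1 v) /= ?ltnn //.
apply: leq_trans (leq_addr _ _).
have -> : (m1 v = m2 v + 1 + (m1 v - m2 v).-1)%N by lia.
rewrite !mulnDl mul1n -!addnA ltn_add2l; apply: leq_trans (leq_addr _ _).
(* The digits after [v] must amount to less than one unit of digit [v]. After multiplication by d +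
   1 each of their powers is at most that of [v], and the digits sum to at most d. *)
rewrite -(ltn_pmul2l (ltn0Sn d)) big_distrr /=.
apply: (@leq_ltn_trans (\sum_(l < n) m2 l * d.+1 ^ (n - v.+1))%N); last first.
  by rewrite -big_distrl /= -mdegE d2 ltn_mul2r expn_gt0 ltnSn.
rewrite [leqRHS](bigID (fun l : 'I_n => ~~ (l < v)%N && (l != v))) /=.
apply: leq_trans (leq_addr _ _); apply: leq_sum => l /andP[lv nlv].
rewrite mulnCA leq_mul2l -expnS leq_pexp2l ?orbT //.
have : (l != v :> nat) by [].
by have := ltn_ord l; lia.
Qed.

Lemma drl_total m1 m2 : m1 != m2 -> drl_lt m1 m2 || drl_lt m2 m1.
Proof.
move=> ne; case: (ltngtP (mdeg m1) (mdeg m2)) => E.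
- by apply/orP; left; apply/drl_ltP; left.
- by apply/orP; right; apply/drl_ltP; left.
have : exists k : nat, (k < n)%N && [exists v : 'I_n, (v == k :> nat) && (m1 v != m2 v)].
  have: ~~ [forall v, m1 v == m2 v].
    by apply: contra ne => /forallP H; apply/eqP/mnmP => v; apply/eqP.
  rewrite negb_forall => /existsP[v nv]; exists v; rewrite ltn_ord /=.
  by apply/existsP; exists v; rewrite eqxx.
move=> ex; case: (ex_minnP ex) => k /andP[kn /existsP[v /andP[/eqP vk nv]]] kmin.
have eq_l (l : 'I_n) : (l < v)%N -> m1 l = m2 l.
  move=> lv; apply/eqP/negPn/negP => nl.
  suff : (k <= l)%N by lia.
  by apply: kmin; rewrite ltn_ord; apply/existsP; exists l; rewrite eqxx.
case: (ltngtP (m1 v) (m2 v)) nv => // lt_v _; apply/orP.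
- right; apply/drl_ltP; right; split; first by rewrite E.
  by exists v; split=> // l /eq_l.
- by left; apply/drl_ltP; right; split=> //; exists v; split.
Qed.

Lemma drl_irr m : drl_lt m m = false.
Proof.
apply/negP => /(drl_weight_lt (erefl _) (erefl _)); by rewrite ltnn.
Qed.

Lemma drl_mdeg m1 m2 : drl_lt m1 m2 -> (mdeg m1 <= mdeg m2)%N.
Proof. by case/drl_ltP => [/ltnW|[-> _]]. Qed.

Lemma drl_asym m1 m2 : drl_lt m1 m2 -> drl_lt m2 m1 = false.
Proof.
move=> H; apply/negP => H'.
have E : mdeg m1 = mdeg m2.
  by apply/eqP; rewrite eqn_leq (drl_mdeg H) (drl_mdeg H').
have := ltn_trans (drl_weight_lt (erefl _) (esym E) H)
                  (drl_weight_lt (esym E) (erefl _) H').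
by rewrite ltnn.
Qed.

Lemma drl_trans m2 m1 m3 : drl_lt m1 m2 -> drl_lt m2 m3 -> drl_lt m1 m3.
Proof.
move=> H H'; have [E|ne] := eqVneq m1 m3.
  by rewrite E drl_asym in H.
have /orP[//|H3] := drl_total ne.
have E12 : mdeg m1 = mdeg m2.
  apply/eqP; rewrite eqn_leq (drl_mdeg H) /=.
  exact: leq_trans (drl_mdeg H') (drl_mdeg H3).
have E23 : mdeg m3 = mdeg m2.
  apply/eqP; rewrite eqn_leq (drl_mdeg H') andbT -E12.
  exact: drl_mdeg H3.
have := ltn_trans (drl_weight_lt E12 (erefl _) H)
          (drl_weight_lt E23 E12 H3).
by rewrite ltnNge (ltnW (drl_weight_lt (erefl _) E23 H')).
Qed.

Lemma drl_add2l a m1 m2 : drl_lt (a + m1)%MM (a + m2)%MM = drl_lt m1 m2.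
Proof.
rewrite /drl_lt !mdegD ltn_add2l eqn_add2l; congr (_ || (_ && _)).
apply: eq_existsb => j; rewrite !mnmDE ltn_add2l; congr (_ && _).
by apply: eq_forallb => l; rewrite !mnmDE eqn_add2l.
Qed.

(* The property of the reverse lexicographic order that makes it compatible with
   quotients and colons by the smallest variable. *)
Lemma drl_lt_supp (v : nat) m1 m2 : mdeg m1 = mdeg m2 -> drl_lt m1 m2 ->
    (forall l : 'I_n, (l < v)%N -> m1 l = 0%N) ->
  (forall l : 'I_n, (l < v)%N -> m2 l = 0%N) /\
  (forall l : 'I_n, l = v :> nat -> (m2 l <= m1 l)%N).
Proof.
move=> E /drl_ltP [|[_ [j [lt_j eq_l]]]]; [by rewrite E ltnn|move=> H].
have vj : (v <= j)%N.
  by rewrite leqNgt; apply/negP => /H H0; rewrite H0 in lt_j.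
split=> l lv; first by rewrite -eq_l ?H //; apply: leq_trans lv vj.
have [lj|jl] := ltnP l j; first by rewrite eq_l.
by have -> : l = j by [apply/val_inj => /=; lia]; apply: ltnW.
Qed.

(** Smaller monomials have larger weight, and the weights in degree d are bounded; the induction is
    on the distance to the bound. *)
Lemma drl_ind (d : nat) (P : 'X_{1..n} -> Prop) :
  (forall m, mdeg m = d ->
     (forall m', mdeg m' = d -> drl_lt m' m -> P m') -> P m) ->
  forall m, mdeg m = d -> P m.
Proof.
move=> IH m0 dm0.
have bound m : mdeg m = d -> (drl_weight d.+1 m <= d * d.+1 ^ n)%N.
  move=> <-; rewrite {2}mdegE /drl_weight big_distrl /=; apply: leq_sum => l _.
  by rewrite leq_mul2l leq_pexp2l ?orbT // leq_subr.
have [k] := ubnP (d * d.+1 ^ n - drl_weight d.+1 m0)%N.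
elim: k m0 dm0 => // k IHk m dm lek; apply: IH => // m' dm' lt_m'; apply: IHk => //.
have := drl_weight_lt dm' dm lt_m'; have := bound _ dm'; have := bound _ dm.
lia.
Qed.

End RevLex.

(** * Leading monomials of homogeneous polynomials *)

Section Leading.

Variables (k : fieldType) (n : nat).
Local Notation S := {mpoly k[n]}.
Implicit Types (f g h : S) (m a : 'X_{1..n}).

Definition mfilter (P : pred 'X_{1..n}) f : S :=
  \sum_(m <- msupp f | P m) f@_m *: 'X_[m].

Lemma mcoeff_mfilter P f m : (mfilter P f)@_m = if P m then f@_m else 0.
Proof.
rewrite /mfilter raddf_sum /= -big_filter.
under eq_bigr => m' _ do rewrite mcoeffZ mcoeffX.
have [min|mnin] := boolP (m \in [seq i <- msupp f | P i]).
  rewrite (bigD1_seq m) ?filter_uniq ?msupp_uniq //= eqxx mulr1 big1 ?addr0.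
    by move: min; rewrite mem_filter => /andP[->].
  by move=> m' /negPf->; rewrite mulr0.
rewrite big_seq big1; last first.
  move=> m' m'in; have [E|_] := eqVneq m' m; last by rewrite mulr0.
  by rewrite -E m'in in mnin.
move: mnin; rewrite mem_filter; case: (P m) => //= H.
by rewrite memN_msupp_eq0.
Qed.

Lemma mcoeff_pihomog d f m :
  (pihomog mdeg d f)@_m = if mdeg m == d then f@_m else 0.
Proof. exact: (mcoeff_mfilter (fun m => mdeg m == d)). Qed.

Lemma mcoeff_mulXm a f m : ('X_[a] * f)@_(a + m) = f@_m.
Proof. by rewrite mulrC mcoeffMX. Qed.

Lemma mcoeff_mulXm0 a f m : ~~ (a <= m)%MM -> ('X_[a] * f)@_m = 0.
Proof.
move=> ndiv; rewrite mulrC.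
apply/eqP; rewrite mcoeff_eq0 (perm_mem (msuppMX _ _)).
by apply: contra ndiv => /mapP[m' _ ->]; apply: lem_addr.
Qed.

Lemma mpolyX_divides a f : (forall m, f@_m != 0 -> (a <= m)%MM) ->
  exists g, f = 'X_[a] * g.
Proof.
move=> H; exists (\sum_(m <- msupp f) f@_m *: 'X_[m - a]).
rewrite mulr_sumr {1}[f]mpolyE big_seq [in RHS]big_seq.
apply: eq_bigr => m; rewrite mcoeff_msupp => /H am.
by rewrite -scalerAr -mpolyXD addmC submK.
Qed.

Lemma dhomog_coeff d f : f \is d.-homog <-> forall m, f@_m != 0 -> mdeg m = d.
Proof.
split=> [/dhomogP H m|H]; first by rewrite -mcoeff_msupp => /H.
by apply/dhomogP => m; rewrite mcoeff_msupp => /H.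
Qed.

Lemma leading_monomialP f m : leading_monomial f m <->
  f@_m != 0 /\ forall m', drl_lt m m' -> f@_m' = 0.
Proof.
rewrite /leading_monomial mcoeff_msupp; split=> -[fm H]; split=> // m'.
  move=> lt_m; apply/eqP; rewrite mcoeff_eq0; apply/negP => /H[E|].
    by rewrite E drl_irr in lt_m.
  by rewrite drl_asym.
rewrite mcoeff_msupp => fm'; have [->|/drl_total/orP[]] := eqVneq m' m; first by left.
  by right.
by move/H => E; rewrite E eqxx in fm'.
Qed.

Lemma leading_monomial_ex f : f != 0 -> exists m, leading_monomial f m.
Proof.
rewrite -msupp_eq0 /leading_monomial.
elim: (msupp f) => // a [_ _|b s IH _].
  by exists a; rewrite mem_head; split=> // m'; rewrite inE => /eqP; left.
have [//|m [ms max]] := IH; have [am|] := boolP (drl_lt a m).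
  exists m; rewrite inE ms orbT; split=> // m'; rewrite inE => /orP[/eqP->|/max//].
  by right.
move=> nam; exists a; rewrite mem_head; split=> // m'.
rewrite inE => /orP[/eqP->|/max H]; first by left.
have [E|ne] := eqVneq m a; first by rewrite -E.
have := drl_total ne; rewrite (negPf nam) orbF => lt_m; right.
by case: H => [->//|H]; apply: drl_trans lt_m.
Qed.

Lemma leading_monomial_homog d f m : f \is d.-homog -> leading_monomial f m -> mdeg m = d.
Proof. by move=> /dhomog_coeff H /leading_monomialP[/H]. Qed.

Lemma leading_monomialX m : leading_monomial ('X_[m] : S) m.
Proof.
apply/leading_monomialP; rewrite mcoeffX eqxx oner_eq0; split=> // m' lt_m.
rewrite mcoeffX; case: eqP => // E; by rewrite E drl_irr in lt_m.
Qed.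

Lemma leading_monomialMX a f m :
  leading_monomial f m -> leading_monomial ('X_[a] * f) (a + m)%MM.
Proof.
case/leading_monomialP => fm H; apply/leading_monomialP.
rewrite mcoeff_mulXm; split=> // m' lt_m.
have [/submK E|/mcoeff_mulXm0->//] := boolP (a <= m')%MM.
by rewrite -E addmC mcoeff_mulXm H // -(drl_add2l a) [(a + (_ - _))%MM]addmC E.
Qed.

Lemma leading_monomial_pihomog f m :
  leading_monomial f m -> leading_monomial (pihomog mdeg (mdeg m) f) m.
Proof.
case/leading_monomialP => fm H; apply/leading_monomialP.
rewrite mcoeff_pihomog eqxx; split=> // m' /H E.
by rewrite mcoeff_pihomog E if_same.
Qed.

Lemma leading_monomial_cancel f h m m' :
    leading_monomial f m -> leading_monomial h m ->
  leading_monomial (f - (f@_m / h@_m) *: h) m' -> drl_lt m' m.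
Proof.
case/leading_monomialP => fm Hf /leading_monomialP[hm Hh] /leading_monomialP[nz _].
rewrite mcoeffB mcoeffZ in nz.
have [E|/drl_total/orP[//|lt_m]] := eqVneq m' m.
  by rewrite E divfK // subrr eqxx in nz.
by rewrite (Hf m') // (Hh m') // mulr0 subr0 eqxx in nz.
Qed.

(** The condition on [g] is vacuous for [g = 0], so a reduction step that ends in zero needs no
    separate case. *)
Lemma dhomog_leading_ind (d : nat) (P : S -> Prop) : P 0 ->
  (forall f m, f \is d.-homog -> leading_monomial f m ->
     (forall g, g \is d.-homog ->
        (forall m', leading_monomial g m' -> drl_lt m' m) -> P g) -> P f) ->
  forall f, f \is d.-homog -> P f.
Proof.
move=> P0 IH f hf; have [->//|/leading_monomial_ex[m lm]] := eqVneq f 0.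
have dm := leading_monomial_homog hf lm.
move: m dm f hf lm; apply: drl_ind => m dm IHm f hf lm.
apply: (IH f m) => // g hg lt_g.
have [->//|/leading_monomial_ex[m' lm']] := eqVneq g 0.
exact: IHm (leading_monomial_homog hg lm') (lt_g _ lm') g hg lm'.
Qed.

End Leading.

(** * Homogeneous ideals, normal forms, colons and saturation *)

Section IdealTheory.

Variables (k : fieldType) (n : nat).
Local Notation S := {mpoly k[n]}.
Implicit Types (f g h : S) (m a : 'X_{1..n}) (I J G : S -> Prop).

Definition is_ideal J :=
  [/\ J 0, forall f g, J f -> J g -> J (f + g) & forall f g, J g -> J (f * g)].

Definition hom_closed J := forall d f, J f -> J (pihomog mdeg d f).

Lemma idealZ J c f : is_ideal J -> J f -> J (c *: f).
Proof. by case=> _ _ mulJ Jf; rewrite -mul_mpolyC; apply: mulJ. Qed.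

Lemma idealB J f g : is_ideal J -> J f -> J g -> J (f - g).
Proof. by case=> _ addJ mulJ Jf Jg; rewrite -mulN1r; apply/addJ/mulJ. Qed.

Lemma ideal_sum J (T : eqType) (s : seq T) (P : pred T) (F : T -> S) : is_ideal J ->
  (forall x, x \in s -> P x -> J (F x)) -> J (\sum_(x <- s | P x) F x).
Proof.
case=> J0 addJ _ JF; rewrite big_seq_cond; elim/big_ind: _ => //.
by move=> x /andP[xs Px]; apply: JF.
Qed.

Lemma ideal_genP G : is_ideal (ideal_gen G).
Proof.
split=> [|_ _ [s [Gs ->]] [t [Gt ->]]|f _ [s [Gs ->]]].
- by exists [::]; rewrite big_nil.
- exists (s ++ t); rewrite big_cat; split=> // x; rewrite mem_cat => /orP[/Gs|/Gt] //.
- exists [seq (f * x.1, x.2) | x <- s]; split; first by move=> _ /mapP[x /Gs Gx ->].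
  by rewrite big_map mulr_sumr; apply: eq_bigr => x _; rewrite mulrA.
Qed.

Lemma ideal_gen_mem G g : G g -> ideal_gen G g.
Proof.
move=> Gg; exists [:: (1, g)]; rewrite big_seq1 mul1r; split=> // x.
by rewrite inE => /eqP->.
Qed.

Lemma ideal_gen_min G J : is_ideal J -> (forall g, G g -> J g) ->
  forall g, ideal_gen G g -> J g.
Proof.
move=> idJ GJ _ [s [Gs ->]]; apply: ideal_sum => // x xs _.
by case: idJ => _ _; apply; apply/GJ/Gs.
Qed.

Definition monomial_ideal (M : 'X_{1..n} -> Prop) : S -> Prop :=
  fun f => forall m, f@_m != 0 -> M m.

Lemma mcoeffM_neq0 f g m : (f * g)@_m != 0 ->
  exists m1 m2, [/\ f@_m1 != 0, g@_m2 != 0 & m = (m1 + m2)%MM].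
Proof.
rewrite -mcoeff_msupp => /msuppM_le /allpairsP[[m1 m2] /= [f1 g2 E]].
by exists m1, m2; rewrite -!mcoeff_msupp.
Qed.

Lemma monomial_idealP (M : 'X_{1..n} -> Prop) :
  (forall a m, M m -> M (a + m)%MM) -> is_ideal (monomial_ideal M).
Proof.
move=> Mup; split=> [m|f g Mf Mg m|f g Mg m]; first by rewrite mcoeff0 eqxx.
- have [E|/Mf//] := eqVneq f@_m 0.
  by rewrite mcoeffD E add0r => /Mg.
- by move/mcoeffM_neq0 => [m1 [m2 [_ /Mg Mm ->]]]; apply: Mup.
Qed.

Lemma monomial_idealX M m : monomial_ideal M 'X_[m] <-> M m.
Proof.
split=> [|Mm m']; first by apply; rewrite mcoeffX eqxx oner_eq0.
by rewrite mcoeffX; have [<-//|_] := eqVneq m m'; rewrite eqxx.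
Qed.

Definition lm J m := exists f, J f /\ leading_monomial f m.

Lemma lm_up J a m : is_ideal J -> lm J m -> lm J (a + m)%MM.
Proof.
case=> _ _ mulJ [f [Jf lf]]; exists ('X_[a] * f).
by split; [apply: mulJ | apply: leading_monomialMX].
Qed.

Lemma lm_homog J m : hom_closed J -> lm J m ->
  exists f, [/\ J f, f \is (mdeg m).-homog & leading_monomial f m].
Proof.
move=> hJ [f [Jf lf]]; exists (pihomog mdeg (mdeg m) f); split; first exact: hJ.
  exact: pihomogP.
exact: leading_monomial_pihomog.
Qed.

(** Leading monomials are closed under multiples, so the polynomials all of whose monomials are
    leading monomials form an ideal, and it contains the generators of the initial ideal. *)
Lemma initial_idealP J m : is_ideal J -> initial_ideal J 'X_[m] <-> lm J m.
Proof.
move=> idJ; split=> [|[f [Jf lf]]]; last first.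
  by apply: ideal_gen_mem; exists f, m.
move=> H; apply/monomial_idealX; move: H; apply: ideal_gen_min.
  by apply: monomial_idealP => a m'; apply: lm_up.
by move=> _ [f [m' [Jf lf ->]]]; apply/monomial_idealX; exists f.
Qed.

(** Division: [f - g] is the normal form of [f]. If it is nonzero, its leading monomial is not one
    of [J], which is how membership in [J] is proved later. *)
Lemma reduction J d f : is_ideal J -> hom_closed J -> f \is d.-homog ->
  exists g, [/\ J g, g \is d.-homog & forall m, (f - g)@_m != 0 -> ~ lm J m].
Proof.
move=> idJ hJ; have [J0 addJ _] := idJ.
move: f; apply: dhomog_leading_ind => [|f m hf lf IH].
  by exists 0; split=> // [|m]; rewrite ?dhomog0 // subr0 mcoeff0 eqxx.
have dm := leading_monomial_homog hf lf.
have [/lm_homog|nJ] := pselect (lm J m).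
  case=> // h [Jh hh lh]; rewrite dm in hh.
  have hc : (f@_m / h@_m) *: h \is d.-homog by apply: dhomogZ.
  have [||g [Jg hg Hg]] := IH (f - (f@_m / h@_m) *: h).
  - by rewrite dhomogD ?dhomogN.
  - by move=> m'; apply: leading_monomial_cancel.
  exists (g + (f@_m / h@_m) *: h); split.
  - by apply: addJ => //; apply: idealZ.
  - exact: dhomogD.
  - by move=> m'; rewrite opprD addrA addrAC; apply: Hg.
have [||g [Jg hg Hg]] := IH (f - f@_m *: 'X_[m]).
- by rewrite rpredB // rpredZ // dhomogX /= dm.
- move=> m' lm'; apply: (leading_monomial_cancel (h := 'X_[m])) lf _ _.
    exact: leading_monomialX.
  by rewrite mcoeffX eqxx divr1.
exists g; split=> // m'; have [->//|ne] := eqVneq m' m.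
move=> nz; apply: Hg; rewrite addrAC mcoeffB mcoeffZ mcoeffX.
by case: (m =P m') => [E|_]; [rewrite E eqxx in ne | rewrite mulr0 subr0].
Qed.

Lemma ideal_homog_sum J f : is_ideal J ->
  (forall d, J (pihomog mdeg d f)) -> J f.
Proof.
move=> idJ H; rewrite (@pihomog_partitionE n k mdeg (msize f) f (leqnn _)).
exact: ideal_sum.
Qed.

Lemma pihomogM d e f g : g \is e.-homog ->
  pihomog mdeg d (f * g) = if (e <= d)%N then pihomog mdeg (d - e) f * g else 0.
Proof.
move=> hg; rewrite (mpolyE f) mulr_suml raddf_sum /=.
have -> : (if (e <= d)%N then pihomog mdeg (d - e) (\sum_(m <- msupp f) f@_m *: 'X_[m]) * g
     else 0) = \sum_(m <- msupp f)
    (if (e <= d)%N then pihomog mdeg (d - e) (f@_m *: 'X_[m]) * g else 0).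
  by case: ifP => _; [rewrite raddf_sum mulr_suml | rewrite big1].
apply: eq_bigr => m _; rewrite -scalerAl !linearZ /= pihomogX.
have hm : 'X_[m] * g \is (mdeg m + e).-homog by rewrite dhomogM // dhomogX.
have [E|ne] := eqVneq (mdeg m + e)%N d.
  by rewrite -E leq_addl addnK eqxx pihomog_dE // scalerAl.
rewrite (pihomog_ne0 ne hm) scaler0; case: ifP => // le_ed.
by case: eqP => [E|]; [rewrite E subnK ?eqxx in ne | rewrite scaler0 mul0r].
Qed.

Lemma principal_addP (a : S) J : is_ideal J -> is_ideal (principal_add a J).
Proof.
move=> [J0 addJ mulJ]; split.
- by exists 0, 0; rewrite mulr0 addr0.
- move=> _ _ [g [h [Jh ->]]] [g' [h' [Jh' ->]]]; exists (g + g'), (h + h').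
  by split; [apply: addJ | rewrite mulrDr addrACA].
- move=> f _ [g [h [Jh ->]]]; exists (f * g), (f * h).
  by split; [apply: mulJ | rewrite mulrDr mulrCA].
Qed.

Lemma principal_add_hom e (a : S) J : a \is e.-homog -> hom_closed J ->
  is_ideal J -> hom_closed (principal_add a J).
Proof.
move=> ha hJ idJ d _ [g [h [Jh ->]]]; rewrite raddfD /= mulrC (pihomogM _ _ ha).
exists (if (e <= d)%N then pihomog mdeg (d - e) g else 0), (pihomog mdeg d h).
by split; [apply: hJ | case: ifP => _; rewrite ?mulr0 // mulrC].
Qed.

Lemma mdeg_ideal_exp e g m : ideal_exp (@maxideal k n) e g -> g@_m != 0 -> (e <= mdeg m)%N.
Proof.
have idM e' : is_ideal (monomial_ideal (fun m => e' <= mdeg m)%N).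
  by apply: monomial_idealP => a m' H; rewrite mdegD (leq_trans H) ?leq_addl.
move=> H; move: m; apply: (ideal_gen_min (idM e) _ H) => _ [t [mt ->]] m.
elim: e t mt m {H} => [|e IH] t mt m //.
rewrite big_ord_recl => /mcoeffM_neq0[m1 [m2 [H1 H2 ->]]].
rewrite mdegD -add1n leq_add //; last first.
  by apply: (IH (fun x => t (lift ord0 x))) H2.
have := mt ord0; move/(ideal_gen_min (idM 1%N)); apply=> // _ [j ->].
by apply/monomial_idealX; rewrite mdeg1.
Qed.

Lemma ideal_expX (j : 'I_n) e : ideal_exp (@maxideal k n) e ('X_j ^+ e).
Proof.
apply: ideal_gen_mem; exists (fun=> 'X_j); rewrite prodr_const card_ord.
by split=> // _; apply: ideal_gen_mem; exists j.
Qed.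

Lemma yvar_lt (i : nat) (lt_in : (i < n)%N) : yvar k n i = 'X_(Ordinal lt_in).
Proof. by rewrite /yvar insubT. Qed.

Lemma yvar_ord (j : 'I_n) : yvar k n j = 'X_j.
Proof. by rewrite (yvar_lt (ltn_ord j)); congr ('X_(_)); apply: val_inj. Qed.

Lemma yvar_ge (i : nat) : (n <= i)%N -> yvar k n i = 0.
Proof. by move=> le_ni; rewrite /yvar insubF // ltnNge le_ni. Qed.

Lemma yvar_homog (i : nat) : yvar k n i \is 1.-homog.
Proof.
have [lt_in|/yvar_ge->] := ltnP i n; last exact: dhomog0.
by rewrite yvar_lt dhomogX /= mdeg1.
Qed.

Definition colon_power J (y : S) : S -> Prop := fun f => exists a : nat, J (y ^+ a * f).

Lemma colon_powerP J (y : S) : is_ideal J -> is_ideal (colon_power J y).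
Proof.
move=> [J0 addJ mulJ]; split.
- by exists 0%N; rewrite mulr0.
- move=> f g [a Ja] [b Jb]; exists (a + b)%N; rewrite mulrDr; apply: addJ.
    by rewrite addnC exprD -mulrA; apply: mulJ.
  by rewrite exprD -mulrA; apply: mulJ.
- by move=> f g [a Ja]; exists a; rewrite mulrCA; apply: mulJ.
Qed.

Lemma colon_power_hom J i : is_ideal J -> hom_closed J ->
  hom_closed (colon_power J (yvar k n i)).
Proof.
move=> idJ hJ d f [e Je]; exists e.
have hy : yvar k n i ^+ e \is e.-homog.
  by have := dhomogMn (p := yvar k n i) (d := 1) e (yvar_homog i); rewrite mul1n.
by have := hJ (e + d)%N _ Je; rewrite mulrC (pihomogM _ _ hy) leq_addr addKn mulrC.
Qed.

Lemma colon_power_sub J y f : J f -> colon_power J y f.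
Proof. by move=> Jf; exists 0%N; rewrite expr0 mul1r. Qed.

(* The hypothesis says that S / J has torsion for y_{i+1} only in degrees <= i.
   For i = n, yvar is 0 and the colon is all of S. *)
Lemma saturationE J i : is_ideal J -> hom_closed J -> (i <= n)%N ->
    (forall d f, f \is d.-homog -> (i < d)%N ->
       colon_power J (yvar k n i) f -> J f) ->
  forall f, saturation J f <-> colon_power J (yvar k n i) f.
Proof.
move=> idJ hJ le_in tors f; split=> [[e H]|cf].
  have [lt_in|/yvar_ge->] := ltnP i n; last first.
    by exists 1%N; rewrite expr1 mul0r; case: idJ.
  by exists e; apply: H; rewrite yvar_lt; apply: ideal_expX.
(* The terms of an element of m^(i+1) have degree > i, so all nonzero components of [g * f] lie in
   the degrees covered by the torsion hypothesis. *)
exists i.+1 => g Hg; apply: ideal_homog_sum => // d.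
have [lt_id|le_di] := ltnP i d; last first.
  suff -> : pihomog mdeg d (g * f) = 0 by case: idJ.
  apply/mpolyP => m; rewrite mcoeff_pihomog mcoeff0; case: eqP => // dm.
  apply/eqP/negPn/negP => /mcoeffM_neq0[m1 [m2 [/(mdeg_ideal_exp Hg) H1 _ E]]].
  by move: dm; rewrite E mdegD; lia.
apply: (tors d) => //; first exact: pihomogP.
apply: colon_power_hom => //.
by have [_ _ mulC] := colon_powerP (yvar k n i) idJ; apply: mulC.
Qed.

End IdealTheory.

(** * Linear changes of coordinates *)

Section LinearSubstitution.

Variables (k : fieldType) (n : nat).
Local Notation S := {mpoly k[n]}.
Implicit Types (f g h : S) (u v : 'M[k]_n) (I J : S -> Prop).

Lemma mpoly_linear_ext (F G : {linear S -> S}) :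
  (forall m, F 'X_[m] = G 'X_[m]) -> F =1 G.
Proof.
move=> FG f; rewrite (mpolyE f) !linear_sum /=; apply: eq_bigr => m _.
by rewrite !linearZZ FG.
Qed.

HB.instance Definition _ u := GRing.LRMorphism.copy (@lin_subst k n u)
  (comp_mpoly [tuple \sum_(i < n) u i j *: ('X_i : S) | j < n]).

Lemma lin_substX u (m : 'X_{1..n}) :
  lin_subst u 'X_[m] = \prod_(j < n) (\sum_(i < n) u i j *: 'X_i) ^+ m j.
Proof.
by rewrite /lin_subst comp_mpolyX; apply: eq_bigr => j _; rewrite tnth_mktuple.
Qed.

Lemma lin_substXU u (j : 'I_n) : lin_subst u 'X_j = \sum_(i < n) u i j *: 'X_i.
Proof.
rewrite lin_substX (bigD1 j) //= mnm1E eqxx expr1 [X in _ * X]big1 => [|i ne].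
  by rewrite mulr1.
by rewrite mnm1E eq_sym (negPf ne) expr0.
Qed.

Lemma lin_subst_comp u v f : lin_subst u (lin_subst v f) = lin_subst (u *m v) f.
Proof.
apply: (mpoly_linear_ext (F := lin_subst u \o lin_subst v)
                         (G := lin_subst (u *m v))) => m /=.
rewrite !lin_substX rmorph_prod; apply: eq_bigr => j _.
rewrite rmorphXn /=; congr (_ ^+ _); rewrite linear_sum /=.
under eq_bigr => i _ do rewrite linearZZ /= lin_substXU scaler_sumr.
rewrite exchange_big; apply: eq_bigr => i _; rewrite mxE scaler_suml.
by apply: eq_bigr => l _; rewrite scalerA mulrC.
Qed.

Lemma lin_subst1 f : lin_subst 1%:M f = f.
Proof.
apply: (mpoly_linear_ext (F := lin_subst 1%:M) (G := idfun)) => m /=.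
rewrite lin_substX mpolyXE_id.
apply: eq_bigr => j _; rewrite (bigD1 j) //= big1 ?addr0 ?mxE ?eqxx ?scale1r //.
by move=> i ne; rewrite mxE (negPf ne) scale0r.
Qed.

Lemma lin_subst_homog u d f : f \is d.-homog -> lin_subst u f \is d.-homog.
Proof.
move=> /dhomogP hf; rewrite (mpolyE f) raddf_sum /= big_seq.
apply: rpred_sum => m /hf <-; rewrite linearZ /=; apply: rpredZ.
rewrite lin_substX mdegE.
have H (s : seq 'I_n) : \prod_(j <- s) (\sum_(i < n) u i j *: ('X_i : S)) ^+ m j
    \is (\sum_(j <- s) m j)%N.-homog.
  elim: s => [|j s IH]; first by rewrite !big_nil dhomog1.
  rewrite !big_cons; apply: dhomogM IH.
  have := @dhomogMn n k mdeg 1%N (\sum_(i < n) u i j *: 'X_i) (m j); rewrite mul1n; apply.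
  by apply: rpred_sum => i _; rewrite rpredZ // dhomogX /= mdeg1.
exact: H.
Qed.

Lemma pihomog_lin_subst u d f :
  pihomog mdeg d (lin_subst u f) = lin_subst u (pihomog mdeg d f).
Proof.
apply: (mpoly_linear_ext (F := pihomog mdeg d \o lin_subst u)
                         (G := lin_subst u \o pihomog mdeg d)) => m /=.
rewrite pihomogX.
have hm : lin_subst u 'X_[m] \is (mdeg m).-homog.
  by apply: lin_subst_homog; rewrite dhomogX /=.
by have [<-|ne] := eqVneq; [rewrite pihomog_dE | rewrite raddf0 (pihomog_ne0 ne hm)].
Qed.

Lemma ideal_imageE u I f : u \in unitmx ->
  ideal_image u I f <-> I (lin_subst (invmx u) f).
Proof.
move=> uu; split=> [[g [Ig ->]]|If].
  by rewrite lin_subst_comp mulVmx // lin_subst1.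
exists (lin_subst (invmx u) f); split=> //.
by rewrite lin_subst_comp mulmxV // lin_subst1.
Qed.

Lemma ideal_imageP u I : u \in unitmx -> is_ideal I -> is_ideal (ideal_image u I).
Proof.
move=> uu [I0 addI mulI]; split=> [|f g|f g]; rewrite !ideal_imageE //.
- by rewrite raddf0.
- by rewrite raddfD; apply: addI.
- by rewrite rmorphM; apply: mulI.
Qed.

Lemma ideal_image_hom u I : hom_closed I -> hom_closed (ideal_image u I).
Proof.
move=> hI d _ [g [Ig ->]]; exists (pihomog mdeg d g); split; first exact: hI.
by rewrite pihomog_lin_subst.
Qed.

End LinearSubstitution.

(** * The Stanley-Reisner ideal in terms of supports of monomials *)

Section StanleyReisner.

Variables (k : fieldType) (n : nat).
Local Notation S := {mpoly k[n]}.
Implicit Types (f g h : S) (m : 'X_{1..n}) (F : {set 'I_n}) (Gamma : {set {set 'I_n}}).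

Definition mnm_supp m : {set 'I_n} := [set j | m j != 0%N].

Lemma monomial_ideal_hom (M : 'X_{1..n} -> Prop) : hom_closed (@monomial_ideal k n M).
Proof.
move=> d f Mf m; rewrite mcoeff_pihomog; case: ifP => _; first exact: Mf.
by rewrite eqxx.
Qed.

Lemma mnm_suppD (m1 m2 : 'X_{1..n}) : mnm_supp (m1 + m2) = mnm_supp m1 :|: mnm_supp m2.
Proof. by apply/setP => l; rewrite !inE mnmDE addn_eq0 negb_and. Qed.

Lemma mnm_supp_mesym1 F : mnm_supp (mesym1 F) = F.
Proof. by apply/setP => j; rewrite inE mnmE; case: (j \in F). Qed.

Definition nonface_ideal Gamma : S -> Prop :=
  monomial_ideal (fun m => mnm_supp m \notin Gamma).

Lemma nonface_idealP Gamma : simplicial_complex Gamma -> is_ideal (nonface_ideal Gamma).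
Proof.
move=> cG; apply: monomial_idealP => a m; apply: contra => /cG; apply.
by rewrite mnm_suppD subsetUr.
Qed.

(** A monomial whose support is a nonface is a multiple of the squarefree generator of that support;
    conversely, supports that contain a nonface are nonfaces. *)
Lemma stanley_reisnerP Gamma f : simplicial_complex Gamma ->
  stanley_reisner k Gamma f <-> nonface_ideal Gamma f.
Proof.
move=> cG; have idM := nonface_idealP cG.
have prodE (F : {set 'I_n}) : \prod_(a in F) 'X_a = 'X_[mesym1 F] :> S.
  rewrite mpolyXE_id big_mkcond; apply: eq_bigr => a _.
  by rewrite mnmE; case: (a \in F); rewrite ?expr1 ?expr0.
split.
  apply: (ideal_gen_min idM) => _ [F [nF ->]]; rewrite prodE.
  by apply/monomial_idealX; rewrite mnm_supp_mesym1.
move=> Mf; rewrite (mpolyE f).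
have idI := ideal_genP (fun f => exists F, F \notin Gamma /\ f = \prod_(a in F) ('X_a : S)).
apply: ideal_sum => // m; rewrite mcoeff_msupp => /Mf nG _; apply: idealZ => //.
have -> : m = ((m - mesym1 (mnm_supp m)) + mesym1 (mnm_supp m))%MM.
  rewrite submK //; apply/mnm_lepP => j; rewrite mnmE inE.
  by case: (m j).
rewrite mpolyXD; case: idI => _ _; apply; apply: ideal_gen_mem.
by exists (mnm_supp m); rewrite prodE.
Qed.

Lemma stanley_reisner_ideal Gamma : is_ideal (stanley_reisner k Gamma).
Proof. exact: ideal_genP. Qed.

Lemma stanley_reisner_hom Gamma : simplicial_complex Gamma ->
  hom_closed (stanley_reisner k Gamma).
Proof.
move=> cG d f; rewrite !stanley_reisnerP //; exact: monomial_ideal_hom.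
Qed.

End StanleyReisner.

(** * Dimensions of quotients by counting leading monomials *)

Section QuotientDimension.

Variables (k : fieldType) (n : nat).
Local Notation S := {mpoly k[n]}.
Implicit Types (f g h : S) (m : 'X_{1..n}) (J K : S -> Prop).

(** Elements of [K] with the leading monomials [mu F] form the basis. They span by division by [J]
    and by themselves; they are independent because a nontrivial combination has one of the [mu F]
    as leading monomial and so is not in [J]. *)
Lemma quot_dim_lm J K (r : nat) (T : finType) (A : {set T}) (mu : T -> 'X_{1..n}) :
    is_ideal J -> hom_closed J -> is_ideal K -> hom_closed K ->
    (forall f, J f -> K f) -> {in A &, injective mu} ->
    (forall F, F \in A -> [/\ mdeg (mu F) = r, lm K (mu F) & ~ lm J (mu F)]) ->
    (forall m, mdeg m = r -> lm K m -> ~ lm J m -> exists2 F, F \in A & mu F = m) ->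
  quot_dim (fun f => f \is r.-homog /\ K f) J #|A|.
Proof.
move=> idJ hJ idK hK sJK inj sound complete; have [J0 addJ _] := idJ.
pose mv (a : 'I_#|A|) := mu (enum_val a).
have injv : injective mv.
  by move=> a b /inj E; apply: enum_val_inj; apply: E; apply: enum_valP.
have /choice[e he] (a : 'I_#|A|) : exists f,
    [/\ K f, f \is r.-homog & leading_monomial f (mv a)].
  have [dm lK _] := sound _ (enum_valP a).
  by have [f [Kf hf lf]] := lm_homog hK lK; rewrite dm in hf; exists f.
exists e; split=> [a|c Jc a|f [hf Kf]]; first by have [] := he a.
  (* The combination of the leading monomials alone; its own leading monomial selects the index [b]
     that dominates among those with nonzero coefficient. *)
  apply/eqP/negPn/negP => nz; pose p : S := \sum_a c a *: 'X_[mv a].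
  have pE b : p@_(mv b) = c b.
    rewrite raddf_sum /= (bigD1 b) //= mcoeffZ mcoeffX eqxx mulr1 big1 ?addr0 //.
    move=> i ne; rewrite mcoeffZ mcoeffX; case: eqP => [/injv E|]; last by rewrite mulr0.
    by rewrite E eqxx in ne.
  have p0 : p != 0 by apply: contraNneq nz => p0; rewrite -pE p0 mcoeff0.
  have [m0 /leading_monomialP[pm0 Hm0]] := leading_monomial_ex p0.
  have [b E] : exists b, mv b = m0.
    apply/not_existsP => H; move: pm0; rewrite raddf_sum big1 ?eqxx //= => i _.
    by rewrite mcoeffZ mcoeffX; case: eqP => [/H//|_]; rewrite mulr0.
  have [_ _] := sound _ (enum_valP b); case; exists (\sum_a c a *: e a); split=> //.
  have lt_c i m' : ~~ drl_lt m' (mv b) -> mv i != m' -> c i * (e i)@_m' = 0.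
    move=> nlt nmi; have [->|ci] := eqVneq (c i) 0; first by rewrite mul0r.
    have [_ _ /leading_monomialP[_ Hi]] := he i; rewrite Hi ?mulr0 //.
    have /orP[//|lt_m'] := drl_total nmi.
    case/negP: nlt; have [<-|/drl_total/orP[|lt_b]] := eqVneq (mv i) (mv b) => //.
      exact: drl_trans.
    by rewrite -pE Hm0 ?eqxx // -E in ci.
  apply/leading_monomialP; split=> [|m' lt_m'].
    rewrite raddf_sum (bigD1 b) //= big1 ?addr0 => [|i ne].
      rewrite mcoeffZ mulf_neq0 //; first by rewrite -pE E.
      by have [_ _ /leading_monomialP[]] := he b.
    by rewrite mcoeffZ lt_c ?drl_irr // (inj_eq injv).
  rewrite raddf_sum big1 //= => i _; rewrite mcoeffZ.
  have [E'|ne] := eqVneq (mv i) m'; last by rewrite lt_c // drl_asym.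
  have -> : c i = 0 by rewrite -pE Hm0 // E' -E.
  by rewrite mul0r.
move: f hf Kf; apply: dhomog_leading_ind => [K0|f m hf lf IH Kf].
  exists (fun=> 0); rewrite big1 ?subrr // => a _; exact: scale0r.
have dm := leading_monomial_homog hf lf.
have lK : lm K m by exists f.
have [/lm_homog|nJ] := pselect (lm J m).
  case=> // h [Jh hh lh]; rewrite dm in hh.
  have [|||c Jc] := IH (f - (f@_m / h@_m) *: h).
  - by rewrite rpredB // rpredZ.
  - by move=> m'; apply: leading_monomial_cancel.
  - by apply: idealB => //; apply: idealZ => //; apply: sJK.
  exists c; rewrite -(subrK ((f@_m / h@_m) *: h) f) addrAC.
  by apply: addJ => //; apply: idealZ.
have [F AF E] := complete m dm lK nJ.
have mb : mv (enum_rank_in AF F) = m by rewrite /mv enum_rankK_in.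
move: (enum_rank_in AF F) mb => b mb; have [Ke hb lb] := he b; rewrite mb in lb.
have [|||c Jc] := IH (f - (f@_m / (e b)@_m) *: e b).
- by rewrite rpredB // rpredZ.
- by move=> m'; apply: leading_monomial_cancel.
- by apply: idealB => //; apply: idealZ.
exists (fun a => c a + (a == b)%:R * (f@_m / (e b)@_m)).
rewrite (eq_bigr (fun a => c a *: e a + ((a == b)%:R * (f@_m / (e b)@_m)) *: e a)); last first.
  by move=> a _; rewrite scalerDl.
rewrite big_split /= [X in _ - (_ + X)](bigD1 b) //= eqxx mul1r [X in _ + (_ + X)]big1.
  by rewrite addr0 opprD addrA addrAC.
by move=> a ne; rewrite (negPf ne) mul0r scale0r.
Qed.

End QuotientDimension.

(** * Leading monomials of the ideals J_i and of their saturations *)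

Section IteratedIdeals.

Variables (k : fieldType) (n : nat).
Local Notation S := {mpoly k[n]}.
Implicit Types (f g h : S) (m a : 'X_{1..n}) (J K : S -> Prop) (v l : 'I_n).

Definition supp_ge (i : nat) m := forall l, (l < i)%N -> m l = 0%N.
Definition supp_lt (i : nat) m := forall l, (i <= l)%N -> m l = 0%N.

Definition supp_geb (i : nat) m := [forall l : 'I_n, (l < i)%N ==> (m l == 0%N)].

Lemma supp_geP i m : reflect (supp_ge i m) (supp_geb i m).
Proof.
apply: (iffP forallP) => H l; first by move=> lv; apply/eqP; apply: (implyP (H l)).
by apply/implyP => lv; rewrite H.
Qed.

(** A monomial without variables before [v] that is smaller than the leading one, in the same
    degree, has at least as large an exponent of ['X_v], and the leading monomial has at least
    [c]. *)
Lemma revlex_divides d f m v c m' : f \is d.-homog ->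
    leading_monomial f (m + U_(v) *+ c)%MM -> supp_ge v m' -> f@_m' != 0 ->
  (U_(v) *+ c <= m')%MM.
Proof.
move=> hf lf ms' nz; have dm' : mdeg m' = mdeg (m + U_(v) *+ c)%MM.
  by rewrite (leading_monomial_homog hf lf); move/dhomog_coeff: hf; apply.
have le_c : (c <= m' v)%N.
  have cm : (c <= (m + U_(v) *+ c)%MM v)%N.
    by rewrite mnmDE mulmnE mnm1E eqxx mul1n leq_addl.
  have [->//|/drl_total/orP[lt_m|lt_m]] := eqVneq m' (m + U_(v) *+ c)%MM.
    have [_ /(_ v erefl)] := drl_lt_supp dm' lt_m ms'.
    exact: leq_trans.
  by case/leading_monomialP: lf => _ H; rewrite H ?eqxx in nz.
apply/mnm_lepP => l; rewrite mulmnE mnm1E; case: (v =P l) => [<-|//].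
by rewrite mul1n.
Qed.

Lemma leading_monomialMXI a f m :
  leading_monomial ('X_[a] * f) (a + m)%MM -> leading_monomial f m.
Proof.
case/leading_monomialP; rewrite mcoeff_mulXm => nz H.
apply/leading_monomialP; split=> // m' lt_m.
by rewrite -(mcoeff_mulXm a) H // drl_add2l.
Qed.

Lemma ideal_varX J l m : is_ideal J -> J 'X_l -> m l != 0%N -> J 'X_[m].
Proof.
move=> [_ _ mulJ] Jl ml; have <- : (m - U_(l) + U_(l) = m)%MM.
  by rewrite submK // lep1mP.
by rewrite mpolyXD; apply: mulJ.
Qed.

(** For the converse, a homogeneous element with leading monomial m y^c is freed from the terms that
    contain variables of [J]; by [revlex_divides] the rest is divisible by y^c, and the quotient has
    leading monomial m. *)
Lemma colon_power_lm J v m : is_ideal J -> hom_closed J ->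
    (forall l, (l < v)%N -> J 'X_l) ->
  lm (colon_power J 'X_v) m <-> exists c, lm J (m + U_(v) *+ c)%MM.
Proof.
move=> idJ hJ Jv; split=> [[f [[c Jf] lf]]|[c lJ]].
  exists c, ('X_v ^+ c * f); split=> //.
  by rewrite mpolyXn addmC; apply: leading_monomialMX.
have [[l [lv ml]]|ms] := pselect (exists l, (l < v)%N /\ m l <> 0%N).
  exists 'X_[m]; split; last exact: leading_monomialX.
  by apply: colon_power_sub; apply: ideal_varX (Jv l lv) _ => //; apply/eqP.
have {}ms : supp_ge v m.
  by move=> l lv; apply: contrapT => ml; apply: ms; exists l.
have [g [Jg hg lg]] := lm_homog hJ lJ.
have lgs : supp_ge v (m + U_(v) *+ c)%MM.
  move=> l lv; rewrite mnmDE mulmnE mnm1E ms //.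
  by case: eqP => [E|//]; rewrite -E ltnn in lv.
pose g0 := mfilter (supp_geb v) g.
have Jg0 : J g0.
  rewrite -(subKr g g0); apply: idealB => //.
  rewrite (mpolyE (g - g0)); apply: ideal_sum => // m'.
  rewrite mcoeff_msupp mcoeffB mcoeff_mfilter => nz _; apply: idealZ => //.
  case: ifP nz => [_|/negP nP _]; first by rewrite subrr eqxx.
  have [l] : exists l, ~ ((l < v)%N -> m' l = 0%N).
    by apply/existsNP => H; apply: nP; apply/supp_geP.
  by move=> /not_implyP[lv /eqP ml]; apply: ideal_varX (Jv l lv) ml.
have lg0 : leading_monomial g0 (m + U_(v) *+ c)%MM.
  case/leading_monomialP: lg => nz H; apply/leading_monomialP.
  rewrite mcoeff_mfilter; case: supp_geP => // _; split=> // m' /H E.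
  by rewrite mcoeff_mfilter E if_same.
have [m'|h gE] := @mpolyX_divides k n (U_(v) *+ c)%MM g0.
  rewrite mcoeff_mfilter; case: supp_geP => [ms' nz|_]; last by rewrite eqxx.
  exact: revlex_divides hg lg ms' nz.
exists h; split; first by exists c; rewrite mpolyXn -gE.
by apply: (@leading_monomialMXI (U_(v) *+ c)%MM); rewrite -gE addmC.
Qed.

(** If [m] avoids ['X_v] and the variables before it, so do all larger monomials of its degree.
    Multiples of ['X_v] contribute to none of them, hence the summand from [K] already has leading
    monomial [m] in that degree. *)
Lemma principal_add_lm K v m : is_ideal K -> hom_closed K ->
    (forall l, (l < v)%N -> K 'X_l) ->
  lm (principal_add 'X_v K) m <-> m v <> 0%N \/ lm K m.
Proof.
move=> idK hK Kv; have [K0 _ _] := idK; split; last first.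
  case=> [/eqP mv|[f [Kf lf]]]; last first.
    by exists f; split=> //; exists 0, f; rewrite mulr0 add0r.
  exists 'X_[m]; split; last exact: leading_monomialX.
  apply: (ideal_varX (l := v)) => //; first exact: principal_addP.
  by exists 1, 0; rewrite mulr1 addr0.
move=> [_ [[g [h [Kh ->]]] lf]].
have [/eqP mv|mv] := boolP (m v == 0%N); last by left; apply/eqP.
right.
have [[l [lv ml]]|ms] := pselect (exists l, (l < v)%N /\ m l <> 0%N).
  exists 'X_[m]; split; last exact: leading_monomialX.
  by apply: ideal_varX (Kv l lv) _ => //; apply/eqP.
have {}ms : supp_ge v.+1 m.
  move=> l lv; apply: contrapT => ml; apply: ms; exists l; split=> //.
  have : (l != v :> nat) by apply/eqP => E; apply: ml; rewrite -mv; congr (m _); apply: val_inj.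
  by move: lv; lia.
have Xg0 m' : supp_ge v.+1 m' -> ('X_v * g)@_m' = 0.
  move=> ms'; apply: mcoeff_mulXm0; rewrite lep1mP negbK; apply/eqP.
  by apply: ms'.
case/leading_monomialP: lf; rewrite mcoeffD Xg0 // add0r => nz H.
exists (pihomog mdeg (mdeg m) h); split; first exact: hK.
apply/leading_monomialP; rewrite mcoeff_pihomog eqxx; split=> // m' lt_m.
rewrite mcoeff_pihomog; case: eqP => // dm; move: (H _ lt_m).
rewrite mcoeffD Xg0 ?add0r //.
by have [] := drl_lt_supp (esym dm) lt_m ms.
Qed.

Variable G : 'X_{1..n} -> Prop.

(** In the 1-based count j = [v] + 1, so [v < mdeg m] reads deg m >= j. *)
Definition multiplication_kernel_bound :=
  forall m v, supp_ge v m -> (v < mdeg m)%N -> G (m + U_(v))%MM -> G m.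

Hypothesis Gbound : multiplication_kernel_bound.

(** The variables of [a] are cancelled one at a time, the one of least index first: the rest of the
    product then involves no earlier variable, as the bound requires. *)
Lemma kernel_bound_iter a m : (forall l, a l != 0%N -> (l < mdeg m)%N) ->
    (forall l l', m l != 0%N -> a l' != 0%N -> (l' <= l)%N) ->
  G (m + a)%MM -> G m.
Proof.
have [c] := ubnP (mdeg a); elim: c a => // c IH a lec Ha Hm Gma.
have [a0|/existsNP[l0 nz]] := pselect (forall l, a l = 0%N).
  by have a00 : a = 0%MM; [apply/mnmP => l; rewrite mnm0E | rewrite a00 addm0 in Gma].
have exl : exists x : nat, [exists l : 'I_n, (l == x :> nat) && (a l != 0%N)].
  by exists l0; apply/existsP; exists l0; rewrite eqxx; apply/eqP.
case: (ex_minnP exl) => x /existsP[l /andP[/eqP lx al]] minx.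
have aE : (a - U_(l) + U_(l) = a)%MM by rewrite submK // lep1mP.
apply: (IH (a - U_(l))%MM).
- by rewrite -ltnS; apply: leq_trans lec; rewrite ltnS -{2}aE mdegD mdeg1 addn1.
- by move=> l'; rewrite mnmBE => H; apply: Ha; apply: contra H => /eqP->.
- by move=> l1 l2 H1; rewrite mnmBE => H; apply: Hm => //; apply: contra H => /eqP->.
apply: (Gbound (v := l)); last by rewrite -addmA aE.
  move=> l' lt_l'; rewrite mnmDE mnmBE.
  have -> : m l' = 0%N.
    by apply/eqP/negPn/negP => /Hm/(_ al); rewrite leqNgt lt_l'.
  have -> : a l' = 0%N; last by [].
  apply/eqP/negPn/negP => al'; have : (x <= l')%N; last by rewrite leqNgt -lx lt_l'.
  by apply: minx; apply/existsP; exists l'; rewrite eqxx.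
by apply: leq_trans (Ha l al) _; rewrite mdegD leq_addr.
Qed.

(** The leading monomials of J_i: the first i variables have been added, and [a] collects the powers
    that the i colon steps cancel. *)
Definition Jlm (i : nat) m :=
  (exists l, (l < i)%N /\ m l <> 0%N) \/ (exists a, supp_lt i a /\ G (m + a)%MM).

(** The power of ['X_v] and the factor [a] involve only indices up to [v], and [m] only indices from
    [v] on. So both cancel, and the new witness is the trivial monomial. *)
Lemma Jlm_kernel_bound v m c : (v < mdeg m)%N ->
  Jlm v (m + U_(v) *+ c)%MM -> Jlm v m.
Proof.
move=> lt_vm; case=> [[l [lv ml]]|[a [sa Ga]]].
  left; exists l; split=> //; move: ml; rewrite mnmDE mulmnE mnm1E.
  by case: eqP => [E|_]; [rewrite E ltnn in lv | rewrite mul0n addn0].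
have [[l [lv ml]]|ms] := pselect (exists l, (l < v)%N /\ m l <> 0%N).
  by left; exists l.
right; exists 0%MM; split; first by move=> l _; rewrite mnm0E.
rewrite addm0; apply: (kernel_bound_iter (a := (U_(v) *+ c + a)%MM)).
- move=> l; rewrite mnmDE mulmnE mnm1E => H; apply: leq_ltn_trans lt_vm.
  rewrite leqNgt; apply/negP => vl; move: H; rewrite sa ?(ltnW vl) // addn0.
  by case: (v =P l) => [E|//]; rewrite E ltnn in vl.
- move=> l l' ml; rewrite mnmDE mulmnE mnm1E => H.
  have vl : (v <= l)%N.
    by rewrite leqNgt; apply/negP => lv; apply: ms; exists l; split=> //; apply/eqP.
  apply: leq_trans vl; rewrite leqNgt; apply/negP => vl'.
  move: H; rewrite sa ?(ltnW vl') // addn0.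
  by case: (v =P l') => [E|//]; rewrite E ltnn in vl'.
by rewrite addmA.
Qed.

Section Chain.

Variables (I : S -> Prop) (u : 'M[k]_n).
Hypothesis idI : is_ideal (ideal_image u I).
Hypothesis hI : hom_closed (ideal_image u I).
Hypothesis lmI : forall m, lm (ideal_image u I) m <-> G m.

Let J := Jideal I u.

(** Invariant of the induction on i; its third clause is what the leading monomials of the next
    colon and the next sum require. *)
Let good (i : nat) := [/\ is_ideal (J i), hom_closed (J i),
  forall l, (l < i)%N -> J i 'X_l & forall m, lm (J i) m <-> Jlm i m].

(** A torsion element of degree > i outside J_i has a nonzero normal form, which is again torsion;
    by the kernel bound its leading monomial is one of J_i, a contradiction. For i = n all variables
    lie in J_n, hence so does everything of positive degree. *)
Lemma saturation_Jideal (i : nat) : (i <= n)%N -> good i ->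
  saturation (J i) = colon_power (J i) (yvar k n i).
Proof.
move=> le_in [idJ hJ Jv lmJ]; apply/funext => f; apply/propext.
apply: saturationE => // d {}f hf lt_id cf; have [J0 addJ mulJ] := idJ.
have [lt_in|le_ni] := ltnP i n; last first.
  rewrite (mpolyE f); apply: ideal_sum => // m; rewrite mcoeff_msupp => fm _.
  apply: idealZ => //; have dm : mdeg m = d by move/dhomog_coeff: hf; apply.
  have [l ml] : exists l, m l <> 0%N.
    apply/existsNP => m0; have E : m = 0%MM by apply/mnmP => l; rewrite m0 mnm0E.
    by move: lt_id; rewrite -dm E mdeg0.
  apply: (ideal_varX (l := l)) => //; last exact/eqP.
  by apply: Jv; apply: leq_trans le_ni.
have [g [Jg hg Hg]] := reduction idJ hJ hf.
have [E|/leading_monomial_ex[m lfm]] := eqVneq (f - g) 0.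
  by rewrite -(subrK g f) E add0r.
exfalso; have [fgm _] := iffLR (leading_monomialP _ _) lfm; apply: (Hg m fgm).
have dm : mdeg m = d.
  by apply: leading_monomial_homog lfm; rewrite rpredB.
apply/lmJ; pose v := Ordinal lt_in.
have [c Jc] : colon_power (J i) (yvar k n i) (f - g).
  by apply: idealB => //; [apply: colon_powerP | apply: colon_power_sub].
apply: (@Jlm_kernel_bound v m c); first by rewrite dm.
apply/lmJ; exists (yvar k n i ^+ c * (f - g)); split=> //.
by rewrite (yvar_lt _ lt_in) mpolyXn addmC; apply: leading_monomialMX.
Qed.

Lemma Jideal_lm (i : nat) : (i <= n)%N -> good i.
Proof.
elim: i => [_|i IH lt_in].
  split=> // m; rewrite lmI; split=> [Gm|[[l []]//|[a [sa]]]].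
    by right; exists 0%MM; rewrite addm0; split=> // l _; rewrite mnm0E.
  by have -> : a = 0%MM; [apply/mnmP => l; rewrite sa ?mnm0E | rewrite addm0].
have gi := IH (ltnW lt_in); have [idJ hJ Jv lmJ] := gi.
have JE : J i.+1 = principal_add (yvar k n i) (colon_power (J i) (yvar k n i)).
  by rewrite /J /= saturation_Jideal // ltnW.
rewrite /good JE; have idC := colon_powerP (yvar k n i) idJ.
have hC := colon_power_hom (i := i) idJ hJ.
pose v := Ordinal lt_in.
split.
- exact: principal_addP.
- by apply: principal_add_hom hC idC; apply: yvar_homog.
- move=> l; rewrite ltnS leq_eqVlt => /orP[/eqP E|li].
    exists 1, 0; split; first by case: idC.
    by rewrite addr0 mulr1 -E yvar_ord.
  by exists 0, 'X_l; rewrite mulr0 add0r; split=> //; apply/colon_power_sub/Jv.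
move=> m; rewrite (yvar_lt _ lt_in) -/v principal_add_lm //; last first.
- by move=> l lv; apply/colon_power_sub/Jv.
- by rewrite -(yvar_lt k lt_in).
- by rewrite -(yvar_lt k lt_in).
rewrite colon_power_lm //; split.
- case=> [mv|[c /lmJ[[l [li ml]]|[a [sa Ga]]]]].
  + by left; exists v; rewrite ltnSn.
  + left; exists l; split; first exact: ltnW.
    move: ml; rewrite mnmDE mulmnE mnm1E.
    by case: eqP => [E|_]; [rewrite -E ltnn in li | rewrite mul0n addn0].
  + right; exists (U_(v) *+ c + a)%MM; rewrite addmA; split=> // l il.
    rewrite mnmDE mulmnE mnm1E sa ?(ltnW il) //.
    by case: eqP => [E|//]; rewrite -E ltnn in il.
- case=> [[l []]|[a [sa Ga]]].
    rewrite ltnS leq_eqVlt => /orP[/eqP E|li] ml.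
      by left; have <- : l = v by apply: val_inj.
    right; exists 0%N; apply/lmJ; left; exists l; split=> //.
    by rewrite mnmDE mulmnE muln0 addn0.
  (* The newest colon cancels the power of ['X_v] in [a]; the rest of [a] belongs to the earlier
     ones. *)
  right; exists (a v); apply/lmJ; right; exists (a - U_(v) *+ a v)%MM; split.
    move=> l il; rewrite mnmBE mulmnE mnm1E.
    have [<-|ne] := eqVneq v l; first by rewrite mul1n subnn.
    rewrite sa // ltn_neqAle il andbT; apply: contra ne => /eqP E.
    by apply/eqP/val_inj.
  rewrite -addmA [X in (m + X)%MM]addmC submK //.
  by apply/mnm_lepP => l; rewrite mulmnE mnm1E; case: eqP => [<-|//]; rewrite mul1n.
Qed.

(** For i = n no ordinal equals i and the condition is vacuous, in accordance with the saturation
    being all of S. *)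
Lemma saturation_lm (i : nat) m : (i <= n)%N ->
  lm (saturation (J i)) m <->
  (forall v, v = i :> nat -> exists c, Jlm i (m + U_(v) *+ c)%MM).
Proof.
move=> le_in; have gi := Jideal_lm le_in; rewrite saturation_Jideal //.
have [idJ hJ Jv lmJ] := gi.
have [lt_in|le_ni] := ltnP i n; last first.
  split=> [_ v E|_]; first by move: (ltn_ord v); rewrite E ltnNge le_ni.
  exists 'X_[m]; split; last exact: leading_monomialX.
  by exists 1%N; rewrite yvar_ge // expr1 mul0r; case: idJ.
rewrite (yvar_lt _ lt_in) colon_power_lm //; split=> [[c lc] v E|H].
  by exists c; apply/lmJ; have -> : v = Ordinal lt_in by apply: val_inj.
by have [c Hc] := H (Ordinal lt_in) erefl; exists c; apply/lmJ.
Qed.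

End Chain.

End IteratedIdeals.

(** * Koszul exactness over the polynomial ring *)

Section PolynomialKoszul.

Variables (k : fieldType) (n : nat).
Hypothesis char0 : [pchar k] =i pred0.
Local Notation S := {mpoly k[n]}.
Implicit Types (f g : S) (W P Q : 'M[k]_n) (a : 'cV[S]_n) (b : 'M[S]_n).

Let natk_eq0 (e : nat) : (e%:R == 0 :> k) = (e == 0%N).
Proof. by have /pcharf0P-> := char0. Qed.

Let natZS (e : nat) (a : 'cV[S]_n) : e%:R%:MP *: a + a = e.+1%:R%:MP *: a.
Proof. by rewrite -natr1 mpolyCD scalerDl mpolyC1 scale1r. Qed.

Let natZK (e : nat) (a : 'cV[S]_n) : (e.+1%:R^-1)%:MP *: (e.+1%:R%:MP *: a) = a.
Proof. by rewrite scalerA -mpolyCM mulVf ?natk_eq0 // mpolyC1 scale1r. Qed.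

Definition linear_forms W : 'cV[S]_n := \col_l lin_subst W 'X_l.

Local Notation C := (map_mx (@mpolyC n k)).

Lemma linear_formsE W l : linear_forms W l 0 = \sum_i W i l *: 'X_i.
Proof. by rewrite mxE lin_substXU. Qed.

Lemma linear_formsM W P : linear_forms (W *m P) = (C P)^T *m linear_forms W.
Proof.
apply/colP => l; rewrite linear_formsE mxE.
under eq_bigr => i _ do rewrite mxE scaler_suml.
rewrite exchange_big; apply: eq_bigr => j _.
rewrite !mxE lin_substXU mul_mpolyC scaler_sumr; apply: eq_bigr => i _.
by rewrite scalerA mulrC.
Qed.

(* The images of the second Koszul differential. *)
Definition koszul_boundary W a := exists b, b^T = - b /\ a = b *m linear_forms W.

Lemma koszul_boundaryD W a a' :
  koszul_boundary W a -> koszul_boundary W a' -> koszul_boundary W (a + a').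
Proof.
move=> [b [bT ->]] [b' [bT' ->]]; exists (b + b').
by rewrite mulmxDl raddfD /= bT bT' opprD.
Qed.

Lemma koszul_boundaryZ W f a : koszul_boundary W a -> koszul_boundary W (f *: a).
Proof.
move=> [b [bT ->]]; exists (f *: b).
by rewrite -scalemxAl linearZ /= bT scalerN.
Qed.

(** By W P = W the transpose of [C P] fixes the vector of forms, and the congruence of [b] by [C P]
    stays skew-symmetric. *)
Lemma koszul_boundary_tr W P a : W *m P = W ->
  koszul_boundary W a -> koszul_boundary W (C P *m a).
Proof.
move=> WP [b [bT ->]]; exists (C P *m b *m (C P)^T); split.
  by rewrite !trmx_mul trmxK bT mulNmx mulmxN mulmxA.
by rewrite -!mulmxA -linear_formsM WP.
Qed.

(** The product is a skew-symmetric 1 by 1 matrix, and 2 is invertible. *)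
Lemma koszul_boundary_cycle W a :
  koszul_boundary W a -> (linear_forms W)^T *m a = 0.
Proof.
move=> [b [bT ->]]; set x := _ *m _.
have xT : x^T = - x.
  by rewrite /x !trmx_mul trmxK bT mulmxN mulNmx mulmxA.
clearbody x; apply/matrixP => i j; rewrite !ord1 [RHS]mxE.
have := congr1 (fun z : 'M_1 => z 0 0) xT; rewrite !mxE => /eqP.
by rewrite -subr_eq0 opprK -mulr2n -scaler_nat scaler_eq0 natk_eq0 => /eqP.
Qed.

Definition dirder P (i : 'I_n) f := \sum_j P i j *: f^`M(j).

Lemma dirder_linear P i : linear (dirder P i).
Proof.
move=> c f g; rewrite /dirder scaler_sumr -big_split; apply: eq_bigr => j _ /=.
by rewrite linearP /= scalerDr !scalerA mulrC.
Qed.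

HB.instance Definition _ P i := GRing.isLinear.Build k S S _ (dirder P i) (dirder_linear P i).

Lemma dirderM P i f g : dirder P i (f * g) = dirder P i f * g + f * dirder P i g.
Proof.
rewrite /dirder mulr_suml mulr_sumr -big_split; apply: eq_bigr => j _ /=.
by rewrite mderivM scalerDr scalerAl scalerAr.
Qed.

Lemma mderivXU (i j : 'I_n) : ('X_j : S)^`M(i) = (i == j)%:R.
Proof.
rewrite mderivX mnm1E eq_sym; case: eqP => [->|_]; last by rewrite scale0r.
rewrite scale1r (_ : (_ - _)%MM = 0%MM) ?mpolyX0 //.
by apply/mnmP => l; rewrite mnmBE subnn mnm0E.
Qed.

Lemma dirder_linear_forms P W i l :
  dirder P i (linear_forms W l 0) = ((P *m W) i l)%:MP.
Proof.
rewrite linear_formsE linear_sum mxE raddf_sum; apply: eq_bigr => j _.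
rewrite linearZ /= /dirder (bigD1 j) //= mderivXU eqxx big1 ?addr0; last first.
  by move=> m ne; rewrite mderivXU (negPf ne) scaler0.
by rewrite scalerA mulrC -alg_mpolyC.
Qed.

Lemma dirder_homog P i e f : f \is e.-homog -> dirder P i f \is e.-1.-homog.
Proof.
move=> /dhomog_coeff hf; apply: rpred_sum => j _; apply: rpredZ.
apply/dhomog_coeff => m; rewrite mcoeff_mderiv => nz.
have /hf : f@_(m + U_(j)) != 0 by apply: contraNneq nz => ->; rewrite mul0rn.
by rewrite mdegD mdeg1 addn1 => <-.
Qed.

Lemma dirder_homog0 P i f : f \is 0.-homog -> dirder P i f = 0.
Proof.
move=> /dhomog_coeff hf; rewrite /dirder big1 // => j _.
suff -> : f^`M(j) = 0 by rewrite scaler0.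
apply/mpolyP => m; rewrite mcoeff_mderiv mcoeff0.
have [->|/hf] := eqVneq (f@_(m + U_(j))) 0; first by rewrite mul0rn.
by rewrite mdegD mdeg1 addn1.
Qed.

Lemma euler_homog e f : f \is e.-homog -> \sum_i 'X_i * f^`M(i) = e%:R *: f.
Proof.
move=> /dhomogP hf; rewrite [in RHS](mpolyE f) scaler_sumr.
have H m : \sum_(i < n) 'X_i * ('X_[m] : S)^`M(i) = (mdeg m)%:R *: 'X_[m].
  rewrite mdegE natr_sum scaler_suml; apply: eq_bigr => i _.
  rewrite mderivX -scalerAr -mpolyXD.
  have [->|mi] := eqVneq (m i) 0%N; first by rewrite !scale0r.
  by rewrite addmC submK // lep1mP.
transitivity (\sum_(i < n) \sum_(m <- msupp f) 'X_i * (f@_m *: 'X_[m])^`M(i)).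
  by apply: eq_bigr => i _; rewrite -mulr_sumr -linear_sum -mpolyE.
rewrite exchange_big big_seq [RHS]big_seq; apply: eq_bigr => m /hf <- /=.
under eq_bigr => i _ do rewrite linearZ /= -scalerAr.
by rewrite -scaler_sumr H scalerA mulrC -scalerA.
Qed.

(* With E the Euler field and WPW = W, the field [sum_l theta_l D_l] differs
   from E by [sum_q y_q (1 - WP)_q], whose components kill the forms theta. *)
Lemma koszul_homotopy W P e a : W *m P *m W = W ->
    (forall l, a l 0 \is e.-homog) -> (linear_forms W)^T *m a = 0 ->
  exists b, b^T = - b /\
    e%:R%:MP *: a + C (P *m W) *m a =
      b *m linear_forms W +
      \sum_q ('X_q : S) *: map_mx (dirder (1%:M - W *m P) q) a.
Proof.
(* The exterior derivative of [a] along the fields D_l. The formula follows from two identities: the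
   relation differentiated along D_i ([Drel]), and Euler's formula split by 1 = WP + (1 - WP)
   ([Eul]). *)
move=> WPW ha rel; pose b : 'M[S]_n := \matrix_(i, l) (dirder P l (a i 0) - dirder P i (a l 0)).
exists b; split.
  by apply/matrixP => i l; rewrite !mxE opprB.
have Drel i : \sum_l (P *m W) i l *: a l 0 +
    \sum_l linear_forms W l 0 * dirder P i (a l 0) = 0.
  have E : \sum_l linear_forms W l 0 * a l 0 = 0.
    have := congr1 (fun z : 'M_1 => z 0 0) rel; rewrite !mxE => E; rewrite -[RHS]E.
    by apply: eq_bigr => l _; rewrite [(_ ^T) _ _]mxE.
  have E0 := congr1 (dirder P i) E; rewrite linear_sum linear0 in E0.
  rewrite -[RHS]E0 -big_split; apply: eq_bigr => l _ /=.
  by rewrite dirderM dirder_linear_forms mul_mpolyC.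
have Eul i : e%:R *: a i 0 = \sum_l linear_forms W l 0 * dirder P l (a i 0) +
    \sum_q 'X_q * dirder (1%:M - W *m P) q (a i 0).
  rewrite -(euler_homog (ha i)).
  have -> : \sum_l linear_forms W l 0 * dirder P l (a i 0) =
            \sum_q 'X_q * dirder (W *m P) q (a i 0).
    under eq_bigr => l _ do rewrite linear_formsE mulr_suml.
    rewrite exchange_big; apply: eq_bigr => q _.
    rewrite /dirder mulr_sumr.
    under eq_bigr => l _ do rewrite mulr_sumr.
    rewrite exchange_big; apply: eq_bigr => j _ /=.
    rewrite mxE scaler_suml mulr_sumr; apply: eq_bigr => l _.
    by rewrite -scalerAl -!scalerAr scalerA.
  rewrite -big_split; apply: eq_bigr => q _ /=.
  rewrite -mulrDr; congr (_ * _); rewrite /dirder -big_split (bigD1 q) //=.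
  have Q1 j : (W *m P) q j + (1%:M - W *m P) q j = (q == j)%:R.
    have <- : (1%:M - W *m P + W *m P) q j = (q == j)%:R by rewrite subrK mxE.
    by rewrite [RHS]mxE addrC.
  rewrite -scalerDl Q1 eqxx scale1r big1 ?addr0 // => j ne.
  by rewrite -scalerDl Q1 eq_sym (negPf ne) scale0r.
apply/colP => i; rewrite ![in LHS]mxE mul_mpolyC Eul.
rewrite [X in _ + X = _](eq_bigr (fun l => (P *m W) i l *: a l 0)); last first.
  by move=> l _; rewrite -mul_mpolyC; congr (_ * _); apply: mxE.
rewrite [in RHS]mxE summxE addrAC; congr (_ + _); last first.
  by apply: eq_bigr => q _; rewrite !mxE.
rewrite mxE [RHS](eq_bigr (fun l => linear_forms W l 0 * dirder P l (a i 0) -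
   linear_forms W l 0 * dirder P i (a l 0))); last first.
  by move=> l _; rewrite [b _ _]mxE mulrBl [X in X - _]mulrC [X in _ - X]mulrC.
rewrite sumrB; congr (_ + _); apply/eqP.
by rewrite -addr_eq0 Drel.
Qed.

Lemma map_dirder_mul P Q q a :
  map_mx (dirder Q q) (C P *m a) = C P *m map_mx (dirder Q q) a.
Proof.
apply/colP => i; rewrite !mxE linear_sum; apply: eq_bigr => l _.
by rewrite !mxE !mul_mpolyC linearZ.
Qed.

Lemma dirder_cycle W Q q a : Q *m W = 0 -> (linear_forms W)^T *m a = 0 ->
  (linear_forms W)^T *m map_mx (dirder Q q) a = 0.
Proof.
move=> QW rel; apply/matrixP => i j; rewrite !ord1 mxE [RHS]mxE.
have := congr1 (fun z : 'M_1 => dirder Q q (z 0 0)) rel.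
rewrite !mxE linear0 linear_sum => E; rewrite -[RHS]E; apply: eq_bigr => l _.
rewrite ![(_ ^T) _ _]mxE [map_mx _ _ _ _]mxE /= dirderM dirder_linear_forms QW [(0 : 'M_n) _ _]mxE.
by rewrite mpolyC0 mul0r add0r.
Qed.

Lemma koszul_boundary_sum W (c : 'I_n -> 'cV[S]_n) :
  (forall q, koszul_boundary W (c q)) -> koszul_boundary W (\sum_q ('X_q : S) *: c q).
Proof.
move=> H; elim/big_ind: _ => [||q _]; last exact: koszul_boundaryZ.
- by exists 0; rewrite trmx0 oppr0 mul0mx.
- exact: koszul_boundaryD.
Qed.

(** Since PW fixes [a], the homotopy writes (e + 1) a as a boundary plus sum_q y_q Q_q a with Q = 1
    - WP. As QW = 0, the Q_q a are again cycles, of degree e - 1, so induction applies; for e = 0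
    they vanish. *)
Lemma koszul_exact_free W P e a : W *m P *m W = W ->
    (forall l, a l 0 \is e.-homog) -> (linear_forms W)^T *m a = 0 ->
    C (P *m W) *m a = a ->
  koszul_boundary W a.
Proof.
move=> WPW; elim: e a => [|e IH] a ha rel Pa;
  have [b [bT E]] := koszul_homotopy WPW ha rel; rewrite Pa in E.
  exists b; split=> //; move: E; rewrite mulr0n mpolyC0 scale0r add0r => ->.
  rewrite big1 ?addr0 // => q _; apply/colP => i.
  by rewrite !mxE dirder_homog0 ?mulr0 //; apply: ha.
rewrite -[a](natZK e.+1) -natZS.
rewrite E; apply/koszul_boundaryZ/koszul_boundaryD; first by exists b.
apply: koszul_boundary_sum => q; apply: IH.
- by move=> l; rewrite mxE; apply: dirder_homog (ha l).
- by apply: dirder_cycle => //; rewrite mulmxBl mul1mx WPW subrr.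
- by rewrite -map_dirder_mul Pa.
Qed.

(** The homotopy makes y = (e + 1) a + PW a a boundary. Applying the idempotent PW gives (e + 2) PW
    a, so PW a and then a are boundaries, after division by e + 1. In degree 0 this fails: constant
    relations among the forms are cycles, but nonzero boundaries have no constant terms. *)
Lemma koszul_exact_full W P e a : W *m P *m W = W ->
    (forall l, a l 0 \is e.+1.-homog) -> (linear_forms W)^T *m a = 0 ->
    (forall q, map_mx (dirder (1%:M - W *m P) q) a = 0) ->
  koszul_boundary W a.
Proof.
move=> WPW ha rel Qa; have [b [bT E]] := koszul_homotopy WPW ha rel.
have Q0 : \sum_q ('X_q : S) *: map_mx (dirder (1%:M - W *m P) q) a = 0.
  by rewrite big1 // => q _; rewrite Qa scaler0.
rewrite Q0 addr0 in E.
set y := _ + _ in E; have By : koszul_boundary W y by exists b.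
have Py : C (P *m W) *m y = (e.+2)%:R%:MP *: (C (P *m W) *m a).
  rewrite /y mulmxDr -scalemxAr [X in _ + X]mulmxA -map_mxM /= -mulmxA.
  by rewrite [W *m (P *m W)]mulmxA WPW natZS.
have -> : a = ((e.+1)%:R^-1)%:MP *: (y + (- (e.+2)%:R^-1)%:MP *: (C (P *m W) *m y)).
  by rewrite Py mpolyCN scaleNr natZK /y addrK natZK.
apply/koszul_boundaryZ/koszul_boundaryD => //; apply: koszul_boundaryZ.
by apply: koszul_boundary_tr By; rewrite mulmxA.
Qed.

End PolynomialKoszul.

(** * Koszul cycles over the Stanley-Reisner ring *)

Section KoszulStanleyReisner.

Variables (k : fieldType) (n : nat).
Hypothesis char0 : [pchar k] =i pred0.
Local Notation S := {mpoly k[n]}.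
Local Notation C := (map_mx (@mpolyC n k)).
Implicit Types (f g : S) (W P : 'M[k]_n) (a y : 'cV[S]_n) (F A : {set 'I_n}).
Implicit Types (Gamma : {set {set 'I_n}}).

Definition restr_mx A : 'M[k]_n := diag_mx (\row_i (i \in A)%:R).

Lemma restr_mxE p A (W : 'M[k]_(n, p)) i l : (restr_mx A *m W) i l = (i \in A)%:R * W i l.
Proof. by rewrite mul_diag_mx !mxE. Qed.

Lemma mul_restr_mxE A W i l : (W *m restr_mx A) i l = W i l * (l \in A)%:R.
Proof. by rewrite mul_mx_diag !mxE. Qed.

Lemma restr_mxK A : restr_mx A *m restr_mx A = restr_mx A.
Proof.
rewrite mulmx_diag; congr diag_mx; apply/rowP => i; rewrite !mxE.
by case: (i \in A); rewrite ?mulr1 ?mulr0.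
Qed.

Lemma restr_mx_id A a : C (restr_mx A) *m a = a <-> forall l, l \notin A -> a l 0 = 0.
Proof.
have E l : (C (restr_mx A) *m a) l 0 = (l \in A)%:R * a l 0.
  rewrite mxE (bigD1 l) //= big1 ?addr0 => [|i ne].
    by rewrite !mxE eqxx mulr1n; case: (l \in A); rewrite ?mpolyC1 ?mpolyC0.
  by rewrite !mxE eq_sym (negPf ne) mulr0n mpolyC0 mul0r.
split=> [H l lA|H]; first by rewrite -H E (negPf lA) mul0r.
apply/colP => l; rewrite E; case: (boolP (l \in A)) => lA; first by rewrite mul1r.
by rewrite mul0r H.
Qed.

Lemma koszul_boundary_pihomog W d y :
  koszul_boundary W y -> koszul_boundary W (map_mx (pihomog mdeg d) y).
Proof.
move=> [b [bT ->]].
exists (map_mx (fun f => if (0 < d)%N then pihomog mdeg d.-1 f else 0) b); split.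
  apply/matrixP => i l; have := congr1 (fun z : 'M_n => z i l) bT.
  by rewrite !mxE => ->; case: ifP; rewrite ?oppr0 // raddfN.
apply/colP => i; rewrite !mxE linear_sum; apply: eq_bigr => l _.
have hl : lin_subst W 'X_l \is 1.-homog.
  by apply: lin_subst_homog; rewrite dhomogX /= mdeg1.
by rewrite !mxE /= (pihomogM _ _ hl) subn1; case: ifP; rewrite ?mul0r.
Qed.

Lemma cycle_coef W a : ((linear_forms W)^T *m a) 0 0 = \sum_l linear_forms W l 0 * a l 0.
Proof. by rewrite mxE; apply: eq_bigr => l _; rewrite [(_ ^T) _ _]mxE. Qed.

(* If F is a facet, the kernel of k[Gamma] -> k[Gamma \ F] is y_F k[y_i : i in F];
   exactness in the middle of the Koszul homology sequence suffices to climb from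
   Gamma \ F to Gamma. *)
Lemma koszul_exact_stanley_reisner W (j d : nat) :
    W *m restr_mx [set l : 'I_n | (l < j)%N] = W ->
    (forall F, exists P, let WF := restr_mx F *m W in WF *m P *m WF = WF /\
        (P *m WF = restr_mx [set l : 'I_n | (l < j)%N] \/
         (#|F| < j)%N /\ WF *m P *m restr_mx F = restr_mx F)) ->
    (j <= d)%N -> forall Gamma a, simplicial_complex Gamma ->
    (forall l, a l 0 \is d.-homog) -> (forall l : 'I_n, (j <= l)%N -> a l 0 = 0) ->
    nonface_ideal Gamma (((linear_forms W)^T *m a) 0 0) ->
  exists y, koszul_boundary W y /\ forall l, nonface_ideal Gamma (a l 0 - y l 0).
Proof.
move=> Wj HW le_jd Gamma; have [c] := ubnP #|Gamma|.
elim: c Gamma => // c IH Gamma leG a cG ha a0 rel.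
have [E|[F1 F1G]] := set_0Vmem Gamma.
  exists 0; split; first by exists 0; rewrite trmx0 oppr0 mul0mx.
  by move=> l m _; rewrite E in_set0.
case: (arg_maxnP (fun F : {set 'I_n} => #|F|) F1G) => F FG maxF.
have {}FG : F \in Gamma := FG.
have facetF i : i \notin F -> i |: F \notin Gamma.
  move=> iF; apply/negP => H; have : (#|i |: F| <= #|F|)%N := maxF _ H.
  by rewrite cardsU1 iF add1n ltnn.
have cG' : simplicial_complex (Gamma :\ F).
  move=> G H; rewrite !in_setD1 => /andP[nGF GG] sHG; rewrite (cG _ _ GG sHG) andbT.
  apply: contra nGF => /eqP E; rewrite eq_sym eqEcard -{1}E sHG /=.
  exact: maxF.
have idG := nonface_idealP k cG; have [_ addG mulG] := idG.
have sub f : nonface_ideal Gamma f -> nonface_ideal (Gamma :\ F) f.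
  by move=> H m /H; rewrite in_setD1 negb_and orbC => ->.
pose E := restr_mx [set l : 'I_n | (l < j)%N].
have [|y0 [By0 Hy0]] := IH (Gamma :\ F) _ a cG' ha a0 (sub _ rel).
  by rewrite (cardsD1 F) FG add1n in leG.
(* [y0] need be neither homogeneous nor confined to the first [j] components; both are restored, and
   nothing is lost because [a] has these properties. *)
pose y1 := C E *m map_mx (pihomog mdeg d) y0.
have By1 : koszul_boundary W y1.
  by apply: koszul_boundary_tr => //; apply: koszul_boundary_pihomog.
pose a1 : 'cV[S]_n := a - y1.
have a1E l : a1 l 0 = if (l < j)%N then pihomog mdeg d (a l 0 - y0 l 0) else 0.
  have y1E : y1 l 0 = (l < j)%N%:R * pihomog mdeg d (y0 l 0).
    rewrite mxE (bigD1 l) //= big1 ?addr0 => [|i ne].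
      by rewrite !mxE eqxx mulr1n inE; case: (l < j)%N; rewrite ?mpolyC1 ?mpolyC0.
    by rewrite !mxE eq_sym (negPf ne) mulr0n mpolyC0 mul0r.
  rewrite mxE [(- y1) _ _]mxE y1E; case: ltnP => lj; last by rewrite a0 // mul0r subr0.
  by rewrite mul1r raddfB /= (pihomog_dE (ha l)).
have ha1 l : a1 l 0 \is d.-homog.
  by rewrite a1E; case: ifP => _; [apply: pihomogP | apply: dhomog0].
have a10 (l : 'I_n) : (j <= l)%N -> a1 l 0 = 0 by rewrite a1E ltnNge => ->.
have Ga1 l : nonface_ideal (Gamma :\ F) (a1 l 0).
  rewrite a1E; case: ifP => _; first by apply: monomial_ideal_hom; apply: Hy0.
  by move=> m; rewrite mcoeff0 eqxx.
have rel1 : nonface_ideal Gamma (((linear_forms W)^T *m a1) 0 0).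
  by rewrite /a1 mulmxBr (koszul_boundary_cycle char0 By1) subr0.
pose XF : S := 'X_[mesym1 F].
(* Modulo nonfaces only the terms of [a1] with support exactly [F] remain, and they are multiples of
   the squarefree monomial [XF]. *)
have /choice[c0 Hc0] (l : 'I_n) : exists g, mfilter (fun m => mnm_supp m == F) (a1 l 0) = XF * g.
  apply: mpolyX_divides => m; rewrite mcoeff_mfilter; case: ifP => [/eqP E0 _|_]; last by rewrite eqxx.
  by apply/mnm_lepP => i; rewrite mnmE -E0 inE; case: (m i).
pose cc : 'cV[S]_n := \col_l c0 l.
have ccE l : XF * cc l 0 = mfilter (fun m => mnm_supp m == F) (a1 l 0).
  by rewrite mxE Hc0.
have Gcc l : nonface_ideal Gamma (a1 l 0 - XF * cc l 0).
  move=> m; rewrite ccE mcoeffB mcoeff_mfilter; case: ifP => [_|/negbT nF].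
    by rewrite subrr eqxx.
  by rewrite subr0 => /Ga1; rewrite in_setD1 nF.
have ccm l m : (cc l 0)@_m != 0 -> mnm_supp m \subset F /\ (#|F| + mdeg m)%N = d.
  rewrite -(mcoeff_mulXm (mesym1 F)) ccE mcoeff_mfilter.
  case: ifP => [/eqP E0 nz|_]; last by rewrite eqxx.
  split; first by rewrite -E0 mnm_suppD subsetUr.
  by rewrite -mdeg_mesym1 -mdegD; move/dhomog_coeff: (ha1 l); apply.
have hcc l : cc l 0 \is (d - #|F|).-homog.
  by apply/dhomog_coeff => m /ccm[_ <-]; rewrite addKn.
have cc0 l : l \notin [set l : 'I_n | (l < j)%N] -> cc l 0 = 0.
  rewrite inE -leqNgt => jl; apply/mpolyP => m.
  by rewrite -(mcoeff_mulXm (mesym1 F)) ccE mcoeff_mfilter a10 // !mcoeff0 if_same.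
pose WF := restr_mx F *m W.
(* On multiples of [XF] the variables outside the facet [F] act as zero in k[Gamma], so each form
   may be replaced by its restriction to [F]. *)
have GW l : nonface_ideal Gamma (XF * (linear_forms W l 0 - linear_forms WF l 0)).
  rewrite !linear_formsE -sumrB mulr_sumr; apply: (ideal_sum idG) => // i _ _.
  rewrite restr_mxE -scalerBl -scalerAr; case: (boolP (i \in F)) => iF.
    by rewrite mul1r subrr scale0r => m; rewrite mcoeff0 eqxx.
  apply: (idealZ _ idG); rewrite -mpolyXD; apply/monomial_idealX.
  rewrite mnm_suppD mnm_supp_mesym1 setUC.
  have -> : mnm_supp U_(i) = [set i]; last exact: facetF.
  by apply/setP => l'; rewrite !inE mnm1E [l' == i]eq_sym; case: (i == l').
(* The left side involves only variables of [F]. Times [XF], all its monomials have support [F], a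
   face; so lying in the ideal forces it to be zero. *)
have relF : (linear_forms WF)^T *m cc = 0.
  apply/matrixP => i0 i1; rewrite !ord1 [RHS]mxE cycle_coef.
  set p := \sum_l _; apply/mpolyP => m; rewrite mcoeff0; apply/eqP/negPn/negP => nz.
  have sm : mnm_supp m \subset F.
    move: nz; have: monomial_ideal (fun m => mnm_supp m \subset F) p; last by apply.
    rewrite /p => m'; rewrite raddf_sum => nz.
    have [l nzl] : exists l, (linear_forms WF l 0 * cc l 0)@_m' != 0.
      apply/not_existsP => H; move/eqP: nz; apply; rewrite big1 // => l _.
      by apply/eqP/negPn/negP; apply: H.
    have [m1 [m2 [H1 /ccm[H2 _] ->]]] := mcoeffM_neq0 nzl.
    rewrite mnm_suppD subUset H2 andbT; move: H1.
    rewrite linear_formsE raddf_sum => nz1.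
    have [i nzi] : exists i, (WF i l *: 'X_i)@_m1 != 0.
      apply/not_existsP => H; move/eqP: nz1; apply; rewrite big1 // => i _.
      by apply/eqP/negPn/negP; apply: H.
    move: nzi; rewrite mcoeffZ restr_mxE mcoeffX.
    case: (boolP (i \in F)) => iF; last by rewrite !mul0r eqxx.
    case: (U_(i)%MM =P m1) => [<- _|_]; last by rewrite mulr0 eqxx.
    by apply/fintype.subsetP => l'; rewrite inE mnm1E; case: (i =P l') => // <-.
  have Gp : nonface_ideal Gamma (XF * p).
    have -> : XF * p = (\sum_l linear_forms W l 0 * a1 l 0 -
        \sum_l linear_forms W l 0 * (a1 l 0 - XF * cc l 0)) -
        \sum_l cc l 0 * (XF * (linear_forms W l 0 - linear_forms WF l 0)).
      have aux (x y z t v : S) : t * (x * y) = z * v - z * (v - t * y) - y * (t * (z - x)).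
        ring.
      by rewrite /p -!sumrB mulr_sumr; apply: eq_bigr => l _; apply: aux.
    apply: (idealB idG) => //; first apply: (idealB idG) => //.
    - by rewrite -cycle_coef.
    - by apply: (ideal_sum idG) => // l _ _; apply: mulG; apply: Gcc.
    - by apply: (ideal_sum idG) => // l _ _; apply: mulG.
  have := Gp (mesym1 F + m)%MM; rewrite mcoeff_mulXm => /(_ nz).
  by rewrite mnm_suppD mnm_supp_mesym1 (setUidPl sm) FG.
have [P [WPW HP]] := HW F; rewrite -/WF in WPW HP.
have [b [bT bE]] : koszul_boundary WF cc.
  case: HP => [PW|[ltFj PF]].
    apply: (koszul_exact_free char0 WPW hcc relF).
    by rewrite PW; apply/restr_mx_id.
  (* Here [#|F| < j <= d] makes the degree of [cc] positive. *)
  have [e dE] : exists e, (d - #|F|)%N = e.+1 by exists (d - #|F|).-1; lia.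
  rewrite dE in hcc; apply: (koszul_exact_full char0 WPW hcc relF) => q.
  (* For [i] in [F] the coefficient of the derivative vanishes, WF P being the identity on [F]; for
     other [i] the derivative does, since [cc] involves only variables of [F]. *)
  apply/colP => l; rewrite [LHS]mxE [RHS]mxE /dirder big1 // => i _.
  have [iF|iF] := boolP (i \in F).
    have : ((1%:M - WF *m P) *m restr_mx F) q i = 0.
      by rewrite mulmxBl mul1mx PF subrr mxE.
    by rewrite mul_restr_mxE iF mulr1 => ->; rewrite scale0r.
  suff -> : (cc l 0)^`M(i) = 0 by rewrite scaler0.
  apply/mpolyP => m; rewrite mcoeff_mderiv mcoeff0.
  have [->|/ccm[/fintype.subsetP/(_ i) H _]] := eqVneq ((cc l 0)@_(m + U_(i))) 0.
    by rewrite mul0rn.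
  by case/negP: iF; apply: H; rewrite inE mnmDE mnm1E eqxx addn1.
exists (y1 + XF *: (b *m linear_forms W)); split.
  exact: (koszul_boundaryD By1 (koszul_boundaryZ XF (ex_intro _ b (conj bT erefl)))).
move=> l; have -> : a l 0 - (y1 + XF *: (b *m linear_forms W)) l 0 =
   (a1 l 0 - XF * cc l 0) - \sum_i b l i * (XF * (linear_forms W i 0 - linear_forms WF i 0)).
  have -> : (y1 + XF *: (b *m linear_forms W)) l 0 =
      y1 l 0 + XF * \sum_i b l i * linear_forms W i 0.
    by rewrite mxE; congr (_ + _); rewrite mxE; congr (_ * _); rewrite mxE.
  have -> : cc l 0 = \sum_i b l i * linear_forms WF i 0 by rewrite bE mxE.
  have -> : a1 l 0 = a l 0 - y1 l 0 by rewrite mxE [(- y1) _ _]mxE.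
  have -> : \sum_i b l i * (XF * (linear_forms W i 0 - linear_forms WF i 0)) =
      XF * (\sum_i b l i * linear_forms W i 0) - XF * (\sum_i b l i * linear_forms WF i 0).
    rewrite -mulrBr -sumrB mulr_sumr; apply: eq_bigr => i _.
    by rewrite -mulrBr mulrCA.
  have aux (x y z s1 s2 : S) :
    x - (y + z * s1) = x - y - z * s2 - (z * s1 - z * s2) by ring.
  exact: aux.
apply: (idealB idG) => //; apply: (ideal_sum idG) => // i _ _; exact: mulG.
Qed.

End KoszulStanleyReisner.

(** * Zariski open sets along curves and generic minors *)

Section Genericity.

Variables (k : fieldType) (n : nat).
Hypothesis char0 : [pchar k] =i pred0.
Local Notation S := {mpoly k[n]}.
Implicit Types (U : 'M[k]_n -> Prop) (A : 'M[{poly k}]_n).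

Lemma natr_inj : injective (fun i : nat => i%:R : k).
Proof.
have H (i j : nat) : (i <= j)%N -> i%:R = j%:R :> k -> i = j.
  move=> le_ij /eqP; rewrite eq_sym -subr_eq0 -natrB //.
  by have /pcharf0P-> := char0; rewrite subn_eq0 => le_ji; apply/eqP; rewrite eqn_leq le_ij.
by move=> i j; case/orP: (leq_total i j) => [/H|/H E /esym/E].
Qed.

Lemma poly_nonroot (p : {poly k}) : p != 0 -> exists t, p.[t] != 0.
Proof.
move=> p0; apply/not_existsP => H.
have := max_poly_roots (rs := [seq i%:R | i <- iota 0 (size p)]) p0.
rewrite size_map size_iota ltnn map_inj_uniq ?iota_uniq; last exact: natr_inj.
suff -> : all (root p) [seq i%:R | i <- iota 0 (size p)] by move/(_ isT isT).
by apply/allP => x _; apply/negPn/negP; apply: H.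
Qed.

Definition mx_eval (t : k) A : 'M[k]_n := map_mx (horner_eval t) A.

(** A defining polynomial pulled back to the curve, times the determinant, is a nonzero polynomial
    in one variable. Genericity thereby reduces to finding a nonroot. *)
Lemma zariski_open_curve U A t0 : zariski_open_GL U -> U (mx_eval t0 A) ->
  exists2 q : {poly k}, q != 0 & forall t, q.[t] != 0 -> U (mx_eval t A).
Proof.
move=> [P HP] /HP[uu [p [Pp /eqP pne]]].
pose pA := \sum_(m <- msupp p) (p@_m)%:P * \prod_i mxvec A 0 i ^+ m i.
have pAE t : pA.[t] = p.@[fun c => mxvec (mx_eval t A) 0 c].
  rewrite mevalE -[LHS]horner_evalE rmorph_sum; apply: eq_bigr => m _ /=.
  rewrite rmorphM /= horner_evalE hornerC rmorph_prod; congr (_ * _).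
  by apply: eq_bigr => i _; rewrite rmorphXn /= /mx_eval -map_mxvec mxE.
have detE t : (\det A).[t] = \det (mx_eval t A).
  by rewrite -[LHS]horner_evalE -det_map_mx.
exists (pA * \det A).
  apply: contraNneq pne => E; rewrite -pAE.
  have := congr1 (fun q : {poly k} => q.[t0]) E; rewrite hornerM horner0 detE => /eqP.
  rewrite mulf_eq0 => /orP[//|/eqP d0].
  by rewrite unitmxE d0 unitr0 in uu.
move=> t; rewrite hornerM pAE detE mulf_eq0 negb_or => /andP[pt dt].
apply/HP; split; first by rewrite unitmxE unitfE.
by exists p; split=> //; apply/eqP.
Qed.

Definition mx_line (u v : 'M[k]_n) : 'M[{poly k}]_n :=
  map_mx polyC u + 'X *: map_mx polyC (v - u).

Lemma mx_eval_line u v t : mx_eval t (mx_line u v) = u + t *: (v - u).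
Proof.
apply/matrixP => i j; rewrite !mxE /horner_eval hornerD hornerC hornerM hornerX.
by rewrite hornerC.
Qed.

Lemma mx_eval_line0 u v : mx_eval 0 (mx_line u v) = u.
Proof. by rewrite mx_eval_line scale0r addr0. Qed.

Lemma mx_eval_line1 u v : mx_eval 1 (mx_line u v) = v.
Proof. by rewrite mx_eval_line scale1r addrC subrK. Qed.

Lemma zariski_open_meet U V u v : zariski_open_GL U -> zariski_open_GL V ->
  U u -> V v -> exists w, U w /\ V w.
Proof.
move=> oU oV Uu Vv.
have [|q1 q1ne H1] := zariski_open_curve (A := mx_line u v) (t0 := 0) oU.
  by rewrite mx_eval_line0.
have [|q2 q2ne H2] := zariski_open_curve (A := mx_line u v) (t0 := 1) oV.
  by rewrite mx_eval_line1.
have [t] := poly_nonroot (mulf_neq0 q1ne q2ne).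
rewrite hornerM mulf_eq0 negb_or => /andP[/H1 Ut /H2 Vt].
by exists (mx_eval t (mx_line u v)).
Qed.

Lemma generic_locus_unit (I : S -> Prop) U u : generic_locus I U -> U u -> u \in unitmx.
Proof. by case=> [[P HP] _ _] /HP[]. Qed.

Lemma generic_locus_lm (I : S -> Prop) U u v m : is_ideal I -> generic_locus I U ->
  U u -> U v -> lm (ideal_image u I) m -> lm (ideal_image v I) m.
Proof.
move=> idI gU Uu Uv; have uu := generic_locus_unit gU Uu.
have uv := generic_locus_unit gU Uv; have [_ _ H] := gU.
move=> lI; apply/initial_idealP; first exact: ideal_imageP.
by apply/(H u v Uu Uv)/initial_idealP => //; apply: ideal_imageP.
Qed.

(** [Gin] refers to some generic locus of its own; that locus meets [U], and a common point compares
    the two initial ideals. *)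
Lemma Gin_lm (I : S -> Prop) U u m : is_ideal I -> generic_locus I U -> U u ->
  Gin I 'X_[m] <-> lm (ideal_image u I) m.
Proof.
move=> idI gU Uu; have uu := generic_locus_unit gU Uu; split=> [[V [gV H]]|lI].
  have [oU _ eqU] := gU; have [oV [v Vv] _] := gV.
  have [w [Uw Vw]] := zariski_open_meet oU oV Uu Vv.
  rewrite -initial_idealP; last exact: ideal_imageP.
  by rewrite (eqU _ w) //; apply: H.
exists U; split=> // v Uv; rewrite initial_idealP.
  exact: (generic_locus_lm idI gU Uu Uv lI).
exact: (ideal_imageP (generic_locus_unit gU Uv) idI).
Qed.

Definition face_row (F : {set 'I_n}) (a : 'I_#|F|) : 'I_n := enum_val a.

Lemma leq_card_face (F : {set 'I_n}) : (#|F| <= n)%N.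
Proof. by rewrite -[leqRHS]card_ord max_card. Qed.

Definition face_col (F : {set 'I_n}) (a : 'I_#|F|) : 'I_n := widen_ord (leq_card_face F) a.

(** Columns of [w] are linear forms and rows are variables: invertibility says that the first [#|F|]
    forms are independent on the variables of [F]. *)
Definition face_minor (R : Type) (w : 'M[R]_n) (F : {set 'I_n}) : 'M[R]_#|F| :=
  mxsub (@face_row F) (@face_col F) w.

Definition vander_mx : 'M[k]_n := \matrix_(i, l) (i%:R ^+ l).

Lemma det_vander_neq0 s (f : 'I_s -> 'I_n) (g : 'I_s -> 'I_n) : injective f ->
  (forall a, g a = a :> nat) -> \det (mxsub f g vander_mx) != 0.
Proof.
move=> injf gE.
have -> : mxsub f g vander_mx = (Vandermonde s (\row_a (f a)%:R))^T.
  by apply/matrixP => a b; rewrite !mxE gE.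
rewrite det_tr det_Vandermonde; apply/prodf_neq0 => a _; apply/prodf_neq0 => b lt_ab.
rewrite !mxE subr_eq0; apply/negP => /eqP/natr_inj/val_inj/injf E.
by rewrite E ltnn in lt_ab.
Qed.

Lemma generic_face_minors U u : zariski_open_GL U -> U u ->
  exists v, U v /\ forall F, face_minor (invmx v) F \in unitmx.
Proof.
(* The minors are those of the inverse, so the line aims at the inverse of the Vandermonde matrix,
   where all of them are Vandermonde determinants. *)
move=> oU Uu; pose u0 := invmx vander_mx.
have uV : vander_mx \in unitmx.
  rewrite unitmxE unitfE -[vander_mx]mxsub_id.
  by apply: det_vander_neq0 => // i j.
have uu0 : u0 \in unitmx by rewrite unitmx_inv.
pose A := mx_line u u0.
(* The adjugate replaces the inverse to keep the minors polynomial in the parameter; the two differ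
   by the factor [\det A]. *)
pose Q F := \det (face_minor (\adj A) F).
have adjE (w : 'M[k]_n) : w \in unitmx -> \adj w = \det w *: invmx w.
  by move=> uw; rewrite /invmx uw scalerA mulrV ?scale1r // -unitmxE.
have QE F t : mx_eval t A \in unitmx ->
    (Q F).[t] = \det (mx_eval t A) ^+ #|F| * \det (face_minor (invmx (mx_eval t A)) F).
  move=> uA; rewrite -detZ -[LHS]horner_evalE -det_map_mx map_mxsub map_mx_adj.
  rewrite -/(mx_eval t A) (adjE _ uA); congr (\det _).
  by apply/matrixP => a b; rewrite !mxE.
have Qne F : Q F != 0.
  suff H : (Q F).[1] != 0 by apply: contraNneq H => ->; rewrite horner0.
  have A1 : mx_eval 1 A = u0 by rewrite mx_eval_line1.
  rewrite QE A1 // mulf_neq0 ?expf_neq0 -?unitfE -?unitmxE //.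
  rewrite invmxK unitmxE unitfE; apply: det_vander_neq0 => // a b.
  exact: enum_val_inj.
have [|q qne Hq] := zariski_open_curve (A := A) (t0 := 0) oU.
  by rewrite mx_eval_line0.
have [|t] := poly_nonroot (p := q * \prod_F Q F).
  by rewrite mulf_neq0 //; apply/prodf_neq0 => F _.
rewrite hornerM mulf_eq0 negb_or => /andP[/Hq Ut Qt].
exists (mx_eval t A); split=> // F; rewrite unitmxE unitfE.
have ut : mx_eval t A \in unitmx by case: oU => P HP; have [] := iffLR (HP _) Ut.
move: Qt; rewrite -horner_evalE rmorph_prod => /prodf_neq0/(_ F isT).
by rewrite /= horner_evalE QE // mulf_eq0 negb_or => /andP[].
Qed.

(** If [j <= #|F|], the first [j] forms are independent on [F] and there is a left inverse;
    otherwise they span the linear forms on [F] and there is a right inverse. Both are the inverse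
    of the minor, carried to full size by the selection matrices [R] (rows in [F]) and [C] (first
    [#|F|] columns). *)
Lemma face_minor_ginv (w : 'M[k]_n) (j : nat) F : face_minor w F \in unitmx ->
  let E := restr_mx k [set l : 'I_n | (l < j)%N] in
  exists P, let WF := restr_mx k F *m (w *m E) in WF *m P *m WF = WF /\
    (P *m WF = E \/ (#|F| < j)%N /\ WF *m P *m restr_mx k F = restr_mx k F).
Proof.
move=> uM E; pose R : 'M[k]_(#|F|, n) := rowsub (@face_row F) 1%:M.
pose C : 'M[k]_(n, #|F|) := colsub (@face_col F) 1%:M.
set M := face_minor w F in uM; have ME : R *m w *m C = M.
  by rewrite /R mul_rowsub_mx mul1mx /C mulmx_colsub mulmx1; apply/matrixP => a b; rewrite !mxE.
have RR : R *m R^T = 1%:M.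
  apply/matrixP => a b; rewrite !mxE (bigD1 (face_row a)) //= !mxE eqxx mul1r.
  rewrite big1 ?addr0 => [|i ne]; last by rewrite !mxE eq_sym (negPf ne) mul0r.
  by rewrite /face_row (inj_eq enum_val_inj) eq_sym.
have RTR : R^T *m R = restr_mx k F.
  apply/matrixP => i l; rewrite [LHS]mxE !mxE; case: (boolP (i \in F)) => iF.
    rewrite (bigD1 (enum_rank_in iF i)) //= !mxE /face_row enum_rankK_in // eqxx mul1r.
    rewrite big1 ?addr0 // => a ne; rewrite !mxE /face_row.
    case: eqP => [E0|]; last by rewrite mul0r.
    by case/eqP: ne; apply: enum_val_inj; rewrite E0 enum_rankK_in.
  rewrite mul0rn big1 // => a _; rewrite !mxE /face_row.
  case: eqP => [E0|]; last by rewrite mul0r.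
  by rewrite -E0 enum_valP in iF.
pose WF := restr_mx k F *m (w *m E).
have EE : E *m E = E by apply: restr_mxK.
have [le_jF|lt_Fj] := leqP j #|F|.
  have CE : C *m C^T *m E = E.
    apply/matrixP => i l; rewrite mul_restr_mxE -[in RHS](mul1mx E) mul_restr_mxE inE.
    case: ltnP => lj; rewrite ?mulr0 // !mulr1.
    pose a := Ordinal (leq_trans lj le_jF).
    have aE : face_col a = l by apply: val_inj.
    rewrite mxE (bigD1 a) //= !mxE aE eqxx mulr1 big1 ?addr0 // => b nb.
    rewrite !mxE; case: (l =P face_col b) => [E0|]; last by rewrite mulr0.
    by case/eqP: nb; apply: val_inj; rewrite /= E0.
  exists (E *m C *m invmx M *m R); rewrite -/WF.
  have PW : E *m C *m invmx M *m R *m WF = E.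
    rewrite /WF -RTR -!mulmxA [R *m (R^T *m _)]mulmxA RR mul1mx.
    rewrite -[X in w *m X]CE !mulmxA -[X in X *m C^T]mulmxA -[X in X *m C^T]mulmxA.
    rewrite [R *m (w *m C)]mulmxA ME mulmxKV // -2!mulmxA [C *m _]mulmxA CE.
    exact: EE.
  split; last by left.
  by rewrite -mulmxA PW /WF -!mulmxA EE.
have EC : E *m C = C.
  apply/matrixP => i a; rewrite restr_mxE !mxE inE.
  case: (i =P face_col a) => [->|_]; last by rewrite mulr0.
  by rewrite (leq_trans (ltn_ord a) (ltnW lt_Fj)) mulr1.
exists (C *m invmx M *m R); rewrite -/WF.
have WP : WF *m (C *m invmx M *m R) = restr_mx k F.
  rewrite /WF -RTR !mulmxA -[_ *m E *m C]mulmxA EC -[R^T *m R *m w]mulmxA.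
  by rewrite -[R^T *m (R *m w) *m C]mulmxA ME mulmxK.
rewrite /= WP; split; first by rewrite /WF mulmxA restr_mxK.
by right; split=> //; apply: restr_mxK.
Qed.

End Genericity.

(** * The kernel bound for generic initial ideals *)

Section KernelBound.

Variables (k : fieldType) (n : nat).
Hypothesis char0 : [pchar k] =i pred0.
Local Notation S := {mpoly k[n]}.
Implicit Types (f g : S) (m : 'X_{1..n}) (l v : 'I_n).

Definition var_combination (j : nat) f := exists c : 'I_n -> S,
  (forall l, (j <= l)%N -> c l = 0) /\ f = \sum_l 'X_l * c l.

Lemma var_combinationP j : is_ideal (var_combination j).
Proof.
split.
- by exists (fun=> 0); rewrite big1 // => l _; rewrite mulr0.
- move=> _ _ [c [c0 ->]] [c' [c0' ->]]; exists (fun l => c l + c' l); split.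
    by move=> l jl; rewrite c0 // c0' // addr0.
  by rewrite -big_split; apply: eq_bigr => l _; rewrite mulrDr.
- move=> f _ [c [c0 ->]]; exists (fun l => f * c l); split.
    by move=> l jl; rewrite c0 // mulr0.
  by rewrite mulr_sumr; apply: eq_bigr => l _; rewrite mulrCA.
Qed.

Lemma var_combinationE (j : nat) f :
  (forall m, f@_m != 0 -> ~ supp_ge j m) -> var_combination j f.
Proof.
move=> H; have idV := var_combinationP j; rewrite (mpolyE f).
apply: (ideal_sum idV) => m; rewrite mcoeff_msupp => /H /existsNP[l].
move=> /not_implyP[lj /eqP ml] _; apply: (idealZ _ idV).
apply: (ideal_varX (l := l)) => //.
exists (fun l' => if l' == l then 1 else 0); split.
  by move=> l' jl'; case: eqP => // E; rewrite E leqNgt lj in jl'.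
rewrite (bigD1 l) //= eqxx mulr1 big1 ?addr0 // => l' /negPf->.
by rewrite mulr0.
Qed.

Lemma mcoeff_var_mul l f m : m l = 0%N -> ('X_l * f)@_m = 0.
Proof. by move=> ml; apply: mcoeff_mulXm0; rewrite lep1mP ml. Qed.

Lemma kernel_bound_of_minors Gamma (u : 'M[k]_n) : simplicial_complex Gamma ->
    u \in unitmx -> (forall F, face_minor (invmx u) F \in unitmx) ->
  multiplication_kernel_bound (lm (ideal_image u (stanley_reisner k Gamma))).
Proof.
move=> cG uu minors m v ms lt_vm; set I := stanley_reisner k Gamma.
have IE f : I f <-> nonface_ideal Gamma f by apply: stanley_reisnerP.
have idI : is_ideal (ideal_image u I) by apply/ideal_imageP/stanley_reisner_ideal.
have hI : hom_closed (ideal_image u I) by apply/ideal_image_hom/stanley_reisner_hom.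
move=> /(lm_homog hI)[f [If hf lf]].
pose d := mdeg m; rewrite mdegD mdeg1 addn1 -/d in hf.
have [f2m f2nz] := iffLR (leading_monomialP _ _) lf.
(* The terms of [f] without variables before [v] are divisible by ['X_v]. So [f] is a combination of
   the variables up to [v], and the coefficient [F v] of ['X_v] carries the monomial [m]. *)
have [m'|fv fvE] := @mpolyX_divides k n U_(v)%MM (mfilter (supp_geb v) f).
  rewrite mcoeff_mfilter; case: supp_geP => [ms' nz|_]; last by rewrite eqxx.
  by have := revlex_divides (m := m) (v := v) (c := 1) hf _ ms' nz; rewrite mulm1n; apply.
have [m'|c [c0 cE]] := @var_combinationE v (f - mfilter (supp_geb v) f).
  rewrite mcoeffB mcoeff_mfilter; case: supp_geP => // ms'.
  by rewrite subrr eqxx.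
pose F l : S := pihomog mdeg d (if l == v then fv else c l).
have F0 l : (v < l)%N -> F l = 0.
  move=> vl; rewrite /F; case: eqP => [E|_]; first by rewrite E ltnn in vl.
  by rewrite c0 ?raddf0 // ltnW.
have fE : f = \sum_l 'X_l * F l.
  have E : f = \sum_l (if l == v then fv else c l) * 'X_l.
    rewrite -[LHS](subrK (mfilter (supp_geb v) f)) cE fvE (bigD1 v) //= c0 // mulr0 add0r addrC.
    rewrite [RHS](bigD1 v) //= eqxx mulrC; congr (_ + _); apply: eq_bigr => l ne.
    by rewrite (negPf ne) mulrC.
  rewrite -(pihomog_dE hf) {1}E linear_sum; apply: eq_bigr => l _.
  have hl : 'X_l \is [in k[n], 1.-homog] by rewrite dhomogX /= mdeg1.
  by rewrite /= (pihomogM _ _ hl) /= subn1 mulrC.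
have Fvm m' : supp_ge v m' -> mdeg m' = d -> (F v)@_m' = f@_(m' + U_(v)).
  move=> ms' dm'; rewrite mcoeff_pihomog dm' eqxx eqxx.
  rewrite -(mcoeff_mulXm U_(v)%MM) -fvE mcoeff_mfilter addmC; case: supp_geP => // nP.
  case: nP => l lv; rewrite mnmDE ms' // mnm1E.
  by case: eqP => // E; rewrite E ltnn in lv.
(* Pulled back by [w], the relation lives in k[Gamma], and ['X_l] becomes the form given by column
   [l] of [w]; [E] discards the forms after [v]. *)
pose w := invmx u; pose E := restr_mx k [set l : 'I_n | (l < v.+1)%N].
pose W := w *m E.
have lfE l : linear_forms W l 0 = if (l <= v)%N then lin_subst w 'X_l else 0.
  rewrite linear_formsE lin_substXU; case: leqP => lv.
    by apply: eq_bigr => i _; rewrite mul_restr_mxE inE ltnS lv mulr1.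
  by rewrite big1 // => i _; rewrite mul_restr_mxE inE ltnS leqNgt lv mulr0 scale0r.
pose a : 'cV[S]_n := \col_l lin_subst w (F l).
have [|||||||y [[b [bT yE]] Hy]] := @koszul_exact_stanley_reisner k n char0 W v.+1 d _ _ _ Gamma a.
- by rewrite -mulmxA restr_mxK.
- by move=> A; apply: face_minor_ginv.
- exact: lt_vm.
- exact: cG.
- by move=> l; rewrite mxE; apply: lin_subst_homog; apply: pihomogP.
- by move=> l vl; rewrite mxE F0 // raddf0.
- rewrite cycle_coef; move: If; rewrite ideal_imageE // IE fE linear_sum -/w.
  congr (nonface_ideal Gamma _); apply: eq_bigr => l _; rewrite lfE [a _ _]mxE /=.
  by case: leqP => lv; [rewrite rmorphM | rewrite F0 // mulr0 raddf0 mulr0].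
(* Hence component [v] of the boundary combines only the forms before [v]. *)
have bvv : b v v = 0.
  have : b v v = - b v v by have := congr1 (fun z : 'M_n => z v v) bT; rewrite !mxE.
  move/eqP; rewrite -subr_eq0 opprK -mulr2n -scaler_nat scaler_eq0.
  by have /pcharf0P-> := char0 => /eqP.
pose z : S := \sum_l 'X_l * (if (l < v)%N then lin_subst u (b v l) else 0).
have zE : lin_subst w z = \sum_l b v l * linear_forms W l 0.
  rewrite /z raddf_sum /=; apply: eq_bigr => l _; rewrite lfE rmorphM /=.
  case: ltngtP => [lv|lv|/val_inj->].
  - by rewrite /w lin_subst_comp mulVmx // lin_subst1 mulrC.
  - by rewrite raddf0 !mulr0.
  - by rewrite bvv raddf0 mul0r mulr0.
pose h : S := F v - z.
have Ih : ideal_image u I h.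
  have := Hy v; rewrite -IE yE [a _ _]mxE mxE -zE => H.
  by rewrite ideal_imageE // /h raddfB.
(* [z] lies in the ideal of the variables before [v], so on monomials avoiding these [h] agrees with
   [F v], that is with [f] divided by ['X_v]; its degree-d part therefore has leading monomial
   [m]. *)
have hm m' : supp_ge v m' -> h@_m' = (F v)@_m'.
  move=> ms'; rewrite /h mcoeffB; suff -> : z@_m' = 0 by rewrite subr0.
  rewrite /z raddf_sum big1 //= => l _.
  case: ltnP => lv; last by rewrite mulr0 mcoeff0.
  by apply: mcoeff_var_mul; apply: ms'.
exists (pihomog mdeg d h); split; first exact: hI.
apply/leading_monomialP; rewrite mcoeff_pihomog eqxx hm // Fvm //; split=> // m' lt_m.
rewrite mcoeff_pihomog; case: eqP => // dm'.
have [ms' _] := drl_lt_supp (esym dm') lt_m ms.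
by rewrite hm // Fvm // f2nz // [(m + _)%MM]addmC [(m' + _)%MM]addmC drl_add2l.
Qed.

(** The leading monomials at [u] are those at the point of [U] where all face minors are
    invertible. *)
Lemma kernel_bound_generic Gamma U (u : 'M[k]_n) : simplicial_complex Gamma ->
    generic_locus (stanley_reisner k Gamma) U -> U u ->
  multiplication_kernel_bound (lm (ideal_image u (stanley_reisner k Gamma))).
Proof.
move=> cG gU Uu m v ms lt_vm; have [oU _ _] := gU.
have idI := stanley_reisner_ideal k Gamma.
have [u' [Uu' minors]] := generic_face_minors char0 oU Uu.
move=> /(generic_locus_lm idI gU Uu Uu') H; apply: (generic_locus_lm idI gU Uu' Uu).
apply: kernel_bound_of_minors H => //; exact: generic_locus_unit gU Uu'.
Qed.

End KernelBound.

(** * Strong stability of generic initial ideals *)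

Section BorelStability.

Variables (k : fieldType) (n : nat).
Hypothesis char0 : [pchar k] =i pred0.
Local Notation S := {mpoly k[n]}.
Implicit Types (f g : S) (m h c : 'X_{1..n}).

Definition mnm_shift m (i j : 'I_n) (e : nat) := (m - U_(i) *+ e + U_(j) *+ e)%MM.

Lemma mnm_shiftE m i j e l : mnm_shift m i j e l = (m l - (i == l) * e + (j == l) * e)%N.
Proof. by rewrite mnmDE mnmBE !mulmnE !mnm1E. Qed.

Lemma mdeg_shift m i j e : (e <= m i)%N -> mdeg (mnm_shift m i j e) = mdeg m.
Proof.
move=> le_e; rewrite mdegD !mdegMn !mdeg1 -{2}[m](@submK _ (U_(i) *+ e)%MM).
  by rewrite mdegD mdegMn mdeg1.
apply/mnm_lepP => l; rewrite mulmnE mnm1E.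
by case: (i =P l) => [<-|_]; rewrite ?mul0n ?mul1n.
Qed.

Lemma drl_lt_shift m (i j : 'I_n) e : (i < j)%N -> (0 < e <= m i)%N ->
  drl_lt m (mnm_shift m i j e).
Proof.
move=> lt_ij /andP[e0 le_e]; apply/drl_ltP; right; rewrite mdeg_shift //; split=> //.
have neq (l : 'I_n) : (l < j)%N -> (j == l) = false.
  by move=> lj; apply/eqP => E; rewrite E ltnn in lj.
exists i; rewrite mnm_shiftE eqxx neq // mul0n mul1n addn0; split; first by lia.
move=> l li; rewrite mnm_shiftE neq ?(ltn_trans li) // mul0n addn0.
by case: (i =P l) => [E|_]; [rewrite E ltnn in li | rewrite mul0n subn0].
Qed.

Definition elementary_mx (i j : 'I_n) (t : k) : 'M[k]_n := 1%:M + t *: delta_mx j i.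

Lemma lin_subst_elementary i j t m : i != j ->
  lin_subst (elementary_mx i j t) 'X_[m] =
  \sum_(e < (m i).+1) ('C(m i, e)%:R * t ^+ e) *: 'X_[mnm_shift m i j e].
Proof.
move=> nij; have XE (l : 'I_n) : \sum_(i0 < n) elementary_mx i j t i0 l *: ('X_i0 : S) =
    'X_l + (if l == i then t *: 'X_j else 0).
  rewrite (eq_bigr (fun i0 => (if i0 == l then 'X_l else 0) +
     (if i0 == j then (if l == i then t *: 'X_j else 0) else 0))); last first.
    move=> i0 _; rewrite !mxE scalerDl; congr (_ + _).
      by case: eqP => [->|_]; rewrite ?scale1r ?scale0r.
    case: (i0 =P j) => [->|_] /=; last by rewrite mulr0 scale0r.
    by case: eqP => _; rewrite ?mulr1 ?mulr0 ?scale0r.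
  by rewrite big_split /= -!big_mkcond !big_pred1_eq.
rewrite lin_substX (bigD1 i) //= XE eqxx.
rewrite (eq_bigr (fun l => ('X_l : S) ^+ m l)); last first.
  by move=> l /negPf nl; rewrite XE nl addr0.
rewrite exprDn mulr_suml; apply: eq_bigr => -[e /= le_e] _.
rewrite mpolyXD [X in _ *: (X * _)]mpolyXE_id [X in _ *: (X * _)](bigD1 i) //=.
rewrite mnmBE mulmnE mnm1E eqxx mul1n -mpolyXn -scaler_nat.
rewrite [X in _ *: (_ * X * _)](eq_bigr (fun l => ('X_l : S) ^+ m l)); last first.
  by move=> l ne; rewrite mnmBE mulmnE mnm1E eq_sym (negPf ne) mul0n subn0.
rewrite exprZn -scalerAr scalerA -scalerAl; congr (_ *: _).
by rewrite mulrAC.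
Qed.

(** Stated over any ring because [t] is also taken to be the polynomial [1 - 'X]. *)
Definition shift_coef (R : comNzRingType) (i j : 'I_n) (t : R) m c : R :=
  \sum_(e < (m i).+1) 'C(m i, e)%:R * t ^+ e * (mnm_shift m i j e == c)%:R.

Lemma mcoeff_elementary i j t m c : i != j ->
  (lin_subst (elementary_mx i j t) 'X_[m])@_c = shift_coef i j t m c.
Proof.
move=> nij; rewrite lin_subst_elementary // raddf_sum; apply: eq_bigr => e _ /=.
by rewrite mcoeffZ mcoeffX.
Qed.

Lemma shift_coef_neq0 (i j : 'I_n) (t : k) m c : (i < j)%N -> shift_coef i j t m c != 0 ->
  c = m \/ drl_lt m c.
Proof.
move=> lt_ij nz; have [[e le_e] /= H] : exists e : 'I_(m i).+1, mnm_shift m i j e = c.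
  apply/not_existsP => H; move/eqP: nz; apply; rewrite /shift_coef big1 // => e _.
  by case: (_ =P c) => [/H//|_]; rewrite mulr0.
case: e le_e H => [|e] le_e <-; last by right; apply: drl_lt_shift.
by left; apply/mnmP => l; rewrite mnm_shiftE !muln0 subn0 addn0.
Qed.

Lemma mnm_shift_inj (i j : 'I_n) m (e e' : nat) : i != j -> (e <= m i)%N ->
  (e' <= m i)%N -> mnm_shift m i j e = mnm_shift m i j e' -> e = e'.
Proof.
move=> nij le_e le_e' /mnmP/(_ i); rewrite !mnm_shiftE eqxx eq_sym (negPf nij).
by lia.
Qed.

Lemma shift_coef_val (i j : 'I_n) (t : k) m e : i != j -> (e <= m i)%N ->
  shift_coef i j t m (mnm_shift m i j e) = 'C(m i, e)%:R * t ^+ e.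
Proof.
move=> nij le_e; rewrite /shift_coef (bigD1 (Ordinal (le_e : e < (m i).+1)%N)) //=.
rewrite eqxx mulr1 big1 ?addr0 // => -[e' le_e'] /= ne.
case: eqP => [/mnm_shift_inj E|]; last by rewrite mulr0.
by case/eqP: ne; apply: val_inj; apply: E.
Qed.

Lemma lin_subst_diag (x : 'rV[k]_n) m :
  lin_subst (diag_mx x) 'X_[m] = (\prod_l x 0 l ^+ m l) *: 'X_[m].
Proof.
rewrite lin_substX -mul_mpolyC rmorph_prod mpolyXE_id -big_split.
apply: eq_bigr => l _ /=; rewrite rmorphXn -exprMn mul_mpolyC; congr (_ ^+ _).
rewrite (bigD1 l) //= big1 ?addr0 ?mxE ?eqxx ?mulr1n // => i ne.
by rewrite mxE (negPf ne) mulr0n scale0r.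
Qed.

Definition borel_stable (G : 'X_{1..n} -> Prop) := forall m (i j : 'I_n),
  (i < j)%N -> m i != 0%N -> G m -> G (m - U_(i) + U_(j))%MM.

Section Degeneration.

Variables (I : S -> Prop) (U : 'M[k]_n -> Prop) (u : 'M[k]_n).
Hypotheses (idI : is_ideal I) (hI : hom_closed I) (gU : generic_locus I U) (Uu : U u).
Variables (m : 'X_{1..n}) (i j : 'I_n).
Hypotheses (lt_ij : (i < j)%N) (mi : m i != 0%N).

Let G := lm (ideal_image u I).
Let d := mdeg m.
Let m' := mnm_shift m i j 1.
Let wt h := drl_weight d.+1 h.

Hypotheses (Gm : G m) (nGm' : ~ G m').

Let nij : i != j.
Proof. by apply: contraTneq lt_ij => ->; rewrite ltnn. Qed.

Let dm' : mdeg m' = d.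
Proof. by rewrite mdeg_shift // lt0n. Qed.

(* At s = 1 this is u; the torus part degenerates uI to its initial ideal as
   s tends to 0, while the elementary part tends to y_i -> y_i + y_j. *)
Let A : 'M[{poly k}]_n :=
  (1%:M + (1 - 'X) *: delta_mx j i) *m diag_mx (\row_l 'X^(d.+1 ^ (n - l.+1))) *m
  map_mx polyC u.

Let mx_evalA s : mx_eval s A =
  elementary_mx i j (1 - s) *m diag_mx (\row_l s ^+ (d.+1 ^ (n - l.+1))) *m u.
Proof.
rewrite /mx_eval /A !map_mxM; congr (_ *m _ *m _).
- rewrite map_mxD map_mx1 map_mxZ map_delta_mx /=.
  by rewrite /horner_eval hornerD hornerN hornerX hornerC.
- apply/matrixP => a b; rewrite !mxE rmorphMn /= rmorphXn /=.
  by rewrite /horner_eval hornerX.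
- by apply/matrixP => a b; rewrite !mxE /= /horner_eval hornerC.
Qed.

Let mx_evalA1 : mx_eval 1 A = u.
Proof.
rewrite mx_evalA subrr /elementary_mx scale0r addr0 mul1mx.
suff -> : diag_mx (\row_l 1 ^+ (d.+1 ^ (n - l.+1))) = 1%:M :> 'M[k]_n by rewrite mul1mx.
by apply/matrixP => a b; rewrite !mxE expr1n.
Qed.

(** As [m'] is not in [G], these are exactly the elements of [G] of degree d above [m']. *)
Let T : seq 'X_{1..n} := [seq h <- [seq bmnm x | x <- enum {: 'X_{1..n < d.+1}}] |
  [&& mdeg h == d, `[< G h >] & ~~ drl_lt h m']].

Let T_P h : reflect [/\ mdeg h = d, G h & drl_lt m' h] (h \in T).
Proof.
rewrite mem_filter; apply: (iffP andP) => [[/and3P[/eqP dh /asboolP Gh nlt] _]|[dh Gh lt_h]].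
  split=> //; have [E|/drl_total] := eqVneq m' h; first by case: nGm'; rewrite E.
  by rewrite (negPf nlt) orbF.
split; first by rewrite dh eqxx (drl_asym lt_h) /= andbT; apply/asboolP.
have lt_hd : (mdeg h < d.+1)%N by rewrite dh.
by apply/mapP; exists (BMultinom lt_hd); rewrite // mem_enum.
Qed.

Let uniqT : uniq T.
Proof. by rewrite filter_uniq // map_inj_uniq ?enum_uniq //; apply: val_inj. Qed.

Let N := size T.
(** Rows are leading monomials of elements of uI, columns the monomials whose coefficients are read
    off; they differ only at index 0, where [m] faces [m']. *)
Let rs (a : 'I_N.+1) := nth m (m :: T) a.
Let cs (a : 'I_N.+1) := nth m (m' :: T) a.

Let rs_T (a : 'I_N.+1) : a != ord0 -> rs a \in T /\ cs a = rs a.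
Proof.
rewrite /rs /cs; case: a => [[|a] lt_a] //= _; split=> //.
by apply: mem_nth.
Qed.

Let rs_lm a : G (rs a) /\ mdeg (rs a) = d.
Proof.
have [->|/rs_T[/T_P[]]] := eqVneq a ord0; last by [].
by rewrite /rs /=.
Qed.

(** Coefficients of the transformed [f a] at the columns, divided by s^(wt (rs a)). A leading
    monomial has the least weight, so the entries are polynomials in s, and at s = 0 only the
    leading term contributes. *)
Let CP (f : 'I_N.+1 -> S) : 'M[{poly k}]_N.+1 := \matrix_(a, b)
  \sum_(h <- msupp (f a)) ((f a)@_h)%:P * 'X^(wt h - wt (rs a)) *
    shift_coef i j (1 - 'X) h (cs b).

(** For suitable s, invertibility of [CP] yields [p] in the transformed ideal with coefficient 1 at
    [m'] and 0 on [T]. Its leading monomial is in [G], hence not [m']; it is not larger, since it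
    would be in [T], nor smaller, since [m'] occurs in [p]. At s = 0 the matrix [A] is singular;
    that point serves only to see that [\det (CP f)] is not the zero polynomial. *)
Lemma degeneration_absurd : False.
Proof.
have uu := generic_locus_unit gU Uu.
have hI' : hom_closed (ideal_image u I) by apply: ideal_image_hom.
have /choice[f Hf] (a : 'I_N.+1) : exists f,
    [/\ ideal_image u I f, f \is d.-homog & leading_monomial f (rs a)].
  have [Ga da] := rs_lm a; have [f [If hf lf]] := lm_homog hI' Ga.
  by rewrite da in hf; exists f.
have wt_lt a h : h \in msupp (f a) -> h != rs a -> (wt (rs a) < wt h)%N.
  have [_ ha la] := Hf a; have [_ da] := rs_lm a.
  rewrite mcoeff_msupp => nz ne; have dh : mdeg h = d by move/dhomog_coeff: ha; apply.
  apply: drl_weight_lt => //; have /orP[//|lt_h] := drl_total ne.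
  by case/leading_monomialP: la => _ H; rewrite H ?eqxx in nz.
have CPE s a b : (CP f a b).[s] = \sum_(h <- msupp (f a))
    (f a)@_h * s ^+ (wt h - wt (rs a)) * shift_coef i j (1 - s) h (cs b).
  rewrite mxE -[LHS]horner_evalE rmorph_sum; apply: eq_bigr => h _.
  rewrite !rmorphM /= rmorphXn /= !horner_evalE hornerC hornerX; congr (_ * _).
  rewrite -horner_evalE rmorph_sum; apply: eq_bigr => e _.
  by rewrite !rmorphM rmorphXn !rmorph_nat /= /horner_eval !hornerE.
(* At s = 0 the entries are multiples of the coefficients of [cs b] in the image of [rs a] under y_i
   -> y_i + y_j. Such an image contains only [rs a] and larger monomials, so the matrix is
   triangular for the order. *)
have CP0 : \det (mx_eval 0 (CP f)) != 0.
  apply/negP => /det0P[v vne vC]; case/negP: vne; apply/eqP/rowP => a; rewrite [RHS]mxE.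
  pose x a := v 0 a * (f a)@_(rs a).
  have rel b : \sum_a x a * shift_coef i j (1 : k) (rs a) (cs b) = 0.
    have := congr1 (fun z : 'rV_N.+1 => z 0 b) vC; rewrite [RHS]mxE mxE => E.
    rewrite -[RHS]E; apply: eq_bigr => a' _; rewrite [mx_eval _ _ _ _]mxE /horner_eval CPE.
    have [_ _ /leading_monomialP[nz _]] := Hf a'; rewrite -mcoeff_msupp in nz.
    rewrite (bigD1_seq _ nz (msupp_uniq _)) /= subnn expr0 mulr1 subr0.
    rewrite big_seq_cond big1 ?addr0 ?mulrA // => h /andP[hs ne].
    by rewrite expr0n subn_eq0 leqNgt wt_lt // mulr0 mul0r.
  (* The other rows start above [m'] and do not reach this column; row 0 has there the coefficient
     'C(m i, 1) = m i. *)
  have x0 : x ord0 = 0.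
    have := rel ord0; rewrite (bigD1 ord0) //= big1 ?addr0 => [|a' ne].
      have -> : rs ord0 = m by [].
      have -> : cs ord0 = m' by [].
      rewrite shift_coef_val ?lt0n // bin1 expr1 mulr1 => /eqP.
      rewrite mulf_eq0 => /orP[/eqP//|].
      by have /pcharf0P-> := char0; rewrite (negPf mi).
    apply/eqP/negPn/negP; rewrite mulf_eq0 negb_or => /andP[_ /(shift_coef_neq0 lt_ij)].
    have [/T_P[_ Ga lt_a] _] := rs_T ne; rewrite /cs /= => -[E|/(drl_trans lt_a)].
      by case: nGm'; rewrite E.
    by rewrite drl_irr.
  suff xa a' : x a' = 0.
    have := xa a; rewrite /x => /eqP; rewrite mulf_eq0 => /orP[/eqP//|].
    by have [_ _ /leading_monomialP[/negPf->]] := Hf a.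
  have [->//|ne] := eqVneq a' ord0; have [_ da'] := rs_lm a'.
  (* Upward in the order: the column of [h] meets only its own row, with coefficient 1, and rows
     with smaller monomials, which are already settled. *)
  suff H h : mdeg h = d -> forall b : 'I_N.+1, b != ord0 -> rs b = h -> x b = 0.
    exact: (H _ da' a' ne erefl).
  move: h; apply: drl_ind => {da' ne} h dh IH {}a' ne E; have := rel a'.
  rewrite (bigD1 a') //= big1 ?addr0 => [|b nb].
    have [_ ->] := rs_T ne; set z := shift_coef _ _ _ _ _.
    suff -> : z = 1 by rewrite mulr1.
    have E0 : rs a' = mnm_shift (rs a') i j 0.
      by apply/mnmP => l; rewrite mnm_shiftE !muln0 subn0 addn0.
    by rewrite /z {2}E0 shift_coef_val // bin0 expr0 mulr1.
  have [->|nb0] := eqVneq b ord0; first by rewrite x0 mul0r.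
  apply/eqP/negPn/negP; rewrite mulf_eq0 negb_or => /andP[xb /(shift_coef_neq0 lt_ij)].
  have [_ ->] := rs_T ne; case=> [E1|lt_b].
    move: nb nb0 ne E1; rewrite /rs; case: (b) => [[|b'] lb]; case: (a') => [[|a''] la] //=.
    move=> nb _ _ E1; case/eqP: nb; apply: val_inj => /=; congr _.+1.
    by apply/eqP; rewrite -(nth_uniq m _ _ uniqT) // E1.
  case/negP: xb; apply/eqP; apply: (IH (rs b)) => //; last by rewrite -E.
  by have [] := rs_lm b.
have oU : zariski_open_GL U by case: gU.
have [|q qne Hq] := zariski_open_curve (A := A) (t0 := 1) oU.
  by rewrite mx_evalA1.
have detne : \det (CP f) != 0.
  apply: contraNneq CP0 => E; rewrite /mx_eval det_map_mx E.
  by rewrite raddf0.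
have [|s] := poly_nonroot char0 (p := q * 'X * \det (CP f)).
  by rewrite !mulf_neq0 ?polyX_eq0.
rewrite !hornerM hornerX !mulf_eq0 !negb_or => /andP[/andP[/Hq Us s0] ds].
have us := generic_locus_unit gU Us.
have {ds} uC : mx_eval s (CP f) \in unitmx by rewrite unitmxE unitfE det_map_mx.
(* This row combines the rows of [CP] into the first unit vector; the powers of s in [t] undo the
   normalization of [CP]. *)
pose v := row ord0 (invmx (mx_eval s (CP f))).
have vC b : \sum_a v 0 a * (CP f a b).[s] = (ord0 == b)%:R.
  have -> : (ord0 == b)%:R = (invmx (mx_eval s (CP f)) *m mx_eval s (CP f)) ord0 b.
    by rewrite mulVmx // mxE.
  by rewrite mxE; apply: eq_bigr => a _; rewrite [v _ _]mxE [mx_eval _ _ _ _]mxE.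
pose t a := v 0 a / s ^+ wt (rs a).
pose F a := lin_subst (mx_eval s A) (lin_subst (invmx u) (f a)).
pose p : S := \sum_a t a *: F a.
have idA : is_ideal (ideal_image (mx_eval s A) I) by apply: ideal_imageP.
have Ip : ideal_image (mx_eval s A) I p.
  apply: (ideal_sum idA) => a _ _; apply: (idealZ _ idA).
  by exists (lin_subst (invmx u) (f a)); split=> //; apply/ideal_imageE => //; have [] := Hf a.
have hp : p \is d.-homog.
  apply: rpred_sum => a _; apply: rpredZ; apply: lin_subst_homog; apply: lin_subst_homog.
  by have [] := Hf a.
have Fcoef a b : (F a)@_(cs b) = s ^+ wt (rs a) * (CP f a b).[s].
  rewrite /F lin_subst_comp mx_evalA -mulmxA mulmxV // mulmx1 -lin_subst_comp.
  have -> : lin_subst (diag_mx (\row_l s ^+ (d.+1 ^ (n - l.+1)))) (f a) =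
      \sum_(h <- msupp (f a)) ((f a)@_h * s ^+ wt h) *: 'X_[h].
    rewrite {1}(mpolyE (f a)) raddf_sum /=; apply: eq_bigr => h _.
    rewrite linearZ /= lin_subst_diag scalerA; congr (_ * _ *: _).
    rewrite /wt /drl_weight -prodrXr; apply: eq_bigr => l _.
    by rewrite mxE -exprM mulnC.
  rewrite CPE mulr_sumr; set E := elementary_mx _ _ _.
  have -> : lin_subst E (\sum_(h <- msupp (f a)) ((f a)@_h * s ^+ wt h) *: 'X_[h]) =
      \sum_(h <- msupp (f a)) ((f a)@_h * s ^+ wt h) *: lin_subst E 'X_[h].
    by rewrite raddf_sum /=; apply: eq_bigr => h _; rewrite linearZ.
  rewrite raddf_sum big_seq [RHS]big_seq; apply: eq_bigr => h hs /=.
  rewrite mcoeffZ mcoeff_elementary // mulrA; congr (_ * _).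
  rewrite mulrCA -exprD subnKC //.
  by have [->//|/(wt_lt a h hs)/ltnW] := eqVneq h (rs a).
have pcoef b : p@_(cs b) = (ord0 == b)%:R.
  rewrite -vC raddf_sum; apply: eq_bigr => a _; rewrite /= mcoeffZ Fcoef mulrA.
  by rewrite divfK // expf_neq0.
have pm' : p@_m' = 1 by have := pcoef ord0.
have pne : p != 0.
  by apply/eqP => E; have /eqP := pm'; rewrite E mcoeff0 eq_sym oner_eq0.
have [mu lmu] := leading_monomial_ex pne.
have Gmu : G mu by apply: (generic_locus_lm idI gU Us Uu); exists p.
have [nz H] := iffLR (leading_monomialP _ _) lmu.
have dmu := leading_monomial_homog hp lmu.
have [E|/drl_total/orP[lt_mu|lt_mu]] := eqVneq m' mu.
- by case: nGm'; rewrite E.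
- have muT : mu \in T by apply/T_P.
  have lt_a : ((index mu T).+1 < N.+1)%N by rewrite ltnS index_mem.
  have := pcoef (Ordinal lt_a); rewrite /cs /= nth_index // => E.
  by rewrite E eqxx in nz.
- by have /eqP := pm'; rewrite H // eq_sym oner_eq0.
Qed.

End Degeneration.

Lemma borel_stable_generic (I : S -> Prop) U (u : 'M[k]_n) : is_ideal I ->
    hom_closed I -> generic_locus I U -> U u ->
  borel_stable (lm (ideal_image u I)).
Proof.
move=> idI hI gU Uu m i j lt_ij mi Gm; apply: contrapT => nG.
apply: (degeneration_absurd idI hI gU Uu lt_ij mi Gm) => H; apply: nG.
by move: H; rewrite /mnm_shift !mulm1n.
Qed.

End BorelStability.

(** * Decreasing sequences and the shift of their entries *)

Section ShiftedLists.

Local Open Scope nat_scope.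

Implicit Types (s t : seq nat) (a b c v : nat).

Definition desc s := sorted (fun x y => (y < x)%N) s.
Definition wdesc s := sorted (fun x y => (y <= x)%N) s.

Definition shift_up s := [seq (nth 0 s a + a)%N | a <- iota 0 (size s)].
(** Phi on 0-based index lists, with truncated subtraction: nothing is truncated when entry [a] is
    at least [a], which is the condition that the indices in Phi be >= 1. *)
Definition shift_down s := [seq (nth 0 s a - a)%N | a <- iota 0 (size s)].

Lemma size_shift_up s : size (shift_up s) = size s.
Proof. by rewrite size_map size_iota. Qed.

Lemma size_shift_down s : size (shift_down s) = size s.
Proof. by rewrite size_map size_iota. Qed.

Lemma nth_shift_up s a : (a < size s)%N -> nth 0 (shift_up s) a = (nth 0 s a + a)%N.
Proof. by move=> lt_a; rewrite (nth_map 0) ?size_iota // nth_iota. Qed.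

Lemma nth_shift_down s a : (a < size s)%N -> nth 0 (shift_down s) a = (nth 0 s a - a)%N.
Proof. by move=> lt_a; rewrite (nth_map 0) ?size_iota // nth_iota. Qed.

Lemma shift_upK s : shift_down (shift_up s) = s.
Proof.
apply: (@eq_from_nth _ 0); rewrite size_shift_down size_shift_up // => a lt_a.
by rewrite nth_shift_down ?size_shift_up // nth_shift_up // addnK.
Qed.

Lemma shift_downK s : (forall a, (a < size s)%N -> (a <= nth 0 s a)%N) ->
  shift_up (shift_down s) = s.
Proof.
move=> H; apply: (@eq_from_nth _ 0); rewrite size_shift_up size_shift_down // => a lt_a.
by rewrite nth_shift_up ?size_shift_down // nth_shift_down // subnK // H.
Qed.

Lemma desc_nth s a b : desc s -> (a <= b)%N -> (b < size s)%N ->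
  (nth 0 s b + (b - a) <= nth 0 s a)%N.
Proof.
move=> /sortedP-/(_ 0) ds; elim: b => [|b IH] le_ab lt_b.
  by move: le_ab; rewrite leqn0 => /eqP->; rewrite addn0.
case: (ltngtP a b.+1) le_ab => // [lt_ab _|-> _]; last by rewrite subnn addn0.
have := IH lt_ab (ltnW lt_b); have := ds b lt_b; lia.
Qed.

Lemma wdesc_nth s a b : wdesc s -> (a <= b)%N -> (b < size s)%N ->
  (nth 0 s b <= nth 0 s a)%N.
Proof.
move=> /sortedP-/(_ 0) ds; elim: b => [|b IH] le_ab lt_b.
  by move: le_ab; rewrite leqn0 => /eqP->.
case: (ltngtP a b.+1) le_ab => // [lt_ab _|-> //].
exact: leq_trans (ds b lt_b) (IH lt_ab (ltnW lt_b)).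
Qed.

Lemma desc_wdesc s : desc s -> wdesc s.
Proof. by apply: sub_sorted => x y; apply: ltnW. Qed.

Lemma shift_up_wdesc s : desc s -> wdesc (shift_up s).
Proof.
move=> ds; apply/(sortedP 0) => a; rewrite size_shift_up => lt_a.
rewrite !nth_shift_up //; last exact: ltnW.
by have := desc_nth ds (leqnSn a) lt_a; lia.
Qed.

Lemma shift_down_desc s : wdesc s -> (forall a, (a < size s)%N -> (a <= nth 0 s a)%N) ->
  desc (shift_down s).
Proof.
move=> ds H; apply/(sortedP 0) => a; rewrite size_shift_down => lt_a.
rewrite !nth_shift_down //; last exact: ltnW.
by have := wdesc_nth ds (leqnSn a) lt_a; have := H _ lt_a; lia.
Qed.

Lemma desc_eq s t : desc s -> desc t -> s =i t -> s = t.
Proof.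
apply: irr_sorted_eq => [x y z|x]; last exact: ltnn.
by move=> H1 H2; apply: ltn_trans H2 H1.
Qed.

Lemma wdesc_eq s t : wdesc s -> wdesc t -> perm_eq s t -> s = t.
Proof.
apply: sorted_eq => [x y z H1 H2|x y]; first exact: leq_trans H2 H1.
by move=> H; apply/eqP; rewrite eqn_leq andbC.
Qed.

Lemma ltn_count_nth s a : desc s -> (a < size s)%N ->
  (a < count (leq (nth 0 s a)) s)%N.
Proof.
move=> ds lt_a; rewrite -{2}(cat_take_drop a.+1 s) count_cat.
suff -> : count (leq (nth 0 s a)) (take a.+1 s) = a.+1 by rewrite leq_addr.
rewrite -[RHS](size_takel lt_a); apply/eqP; rewrite -all_count; apply/(all_nthP 0) => b.
rewrite size_takel // ltnS => le_ba; rewrite nth_take ?ltnS //.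
by apply: wdesc_nth => //; apply: desc_wdesc.
Qed.

Lemma count_nth_leq s a v : desc s -> (a < count (leq v) s)%N -> (v <= nth 0 s a)%N.
Proof.
move=> ds lt_a; have lt_as : (a < size s)%N by apply: leq_trans lt_a (count_size _ _).
rewrite leqNgt; apply/negP => lt_v; move: lt_a.
rewrite -{1}(cat_take_drop a s) count_cat.
have -> : count (leq v) (drop a s) = 0%N.
  apply/eqP; rewrite -leqn0 leqNgt -has_count -all_predC; apply/(all_nthP 0) => b.
  rewrite size_drop nth_drop /= -ltnNge => lt_b; apply: leq_ltn_trans lt_v.
  by apply: wdesc_nth (desc_wdesc ds) _ _; [apply: leq_addr | lia].
by rewrite addn0 ltnNge (leq_trans (count_size _ _)) // size_take lt_as.
Qed.

(** In a decreasing list, entry [a] is at least v exactly when more than [a] entries are; counts are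
    what can be compared for sets. *)
Lemma desc_dominance s t : desc s -> desc t ->
    (forall v, (count (leq v) s <= count (leq v) t)%N) ->
  (size s <= size t)%N /\ forall a, (a < size s)%N -> (nth 0 s a <= nth 0 t a)%N.
Proof.
move=> ds dt H; split; first by have := H 0; rewrite !count_predT.
by move=> a lt_a; apply: count_nth_leq => //; apply: leq_trans (ltn_count_nth ds lt_a) (H _).
Qed.

Lemma mem_rev_iota c v : (v \in rev (iota 0 c)) = (v < c).
Proof. by rewrite mem_rev mem_iota. Qed.

Lemma desc_cat_iota s c : desc s -> all (leq c) s -> desc (s ++ rev (iota 0 c)).
Proof.
move=> ds /allP H; rewrite /desc sorted_pairwise; last first.
  by move=> x y z H1 H2; apply: ltn_trans H2 H1.
rewrite pairwise_cat -!sorted_pairwise; try by move=> x y z H1 H2; apply: ltn_trans H2 H1.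
rewrite rev_sorted iota_ltn_sorted -/(desc s) ds !andbT; apply/allrelP => x y /H cx.
by rewrite mem_rev_iota => lt_y; apply: leq_trans lt_y cx.
Qed.

(** Position [size s + b] holds [c - 1 - b], so the shift makes the block constant. This is how
    [i-r], preceded by r larger vertices, becomes y_i^(i-r). *)
Lemma shift_up_cat_iota s c :
  shift_up (s ++ rev (iota 0 c)) = shift_up s ++ nseq c (size s + c).-1.
Proof.
apply: (@eq_from_nth _ 0).
  by rewrite size_shift_up !size_cat size_shift_up size_rev size_iota size_nseq.
rewrite size_shift_up size_cat size_rev size_iota => a lt_a.
rewrite nth_shift_up ?size_cat ?size_rev ?size_iota // !nth_cat size_shift_up.
case: ltnP => lt_as; first by rewrite nth_shift_up.
rewrite nth_rev ?size_iota; last by lia.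
rewrite nth_iota; last by lia.
by rewrite nth_nseq ifT; lia.
Qed.

End ShiftedLists.

(** * Monomials as index lists and the inverse of Phi *)

Section MonomialsOfLists.

Local Open Scope nat_scope.

Variable n : nat.
Implicit Types (s t : seq nat) (m : 'X_{1..n}) (F : {set 'I_n}).

Definition mnm_of_seq s : 'X_{1..n} := [multinom count_mem (j : nat) s | j < n].

Lemma mnm_of_seqE s (j : 'I_n) : mnm_of_seq s j = count_mem (j : nat) s.
Proof. exact: mnmE. Qed.

Lemma mnm_of_cat s t : mnm_of_seq (s ++ t) = (mnm_of_seq s + mnm_of_seq t)%MM.
Proof. by apply/mnmP => j; rewrite mnmDE !mnm_of_seqE count_cat. Qed.

Lemma mnm_of_cons (v : 'I_n) s : mnm_of_seq ((v : nat) :: s) = (U_(v) + mnm_of_seq s)%MM.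
Proof.
apply/mnmP => j; rewrite mnmDE !mnm_of_seqE mnm1E /=.
by congr (_ + _)%N.
Qed.

Lemma mdeg_mnm_of_seq s : all (gtn n) s -> mdeg (mnm_of_seq s) = size s.
Proof.
elim: s => [_|x s IH /= /andP[lt_x /IH <-]].
  by rewrite mdegE big1 // => j _; rewrite mnm_of_seqE.
by rewrite (mnm_of_cons (Ordinal lt_x)) mdegD mdeg1.
Qed.

Lemma mnm_of_seq_inj s t : all (gtn n) s -> all (gtn n) t ->
  mnm_of_seq s = mnm_of_seq t -> perm_eq s t.
Proof.
move=> /allP Hs /allP Ht /mnmP E; apply/allP => x.
rewrite mem_cat => Hx; have lt_x : (x < n)%N by case/orP: Hx => [/Hs|/Ht].
by have := E (Ordinal lt_x); rewrite !mnm_of_seqE => /= ->.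
Qed.

Lemma mnm_of_nseq c (v : 'I_n) : mnm_of_seq (nseq c (v : nat)) = (U_(v) *+ c)%MM.
Proof.
by apply/mnmP => j; rewrite mnm_of_seqE count_nseq mulmnE mnm1E.
Qed.

(* Zero-based, unlike [mindices]. *)
Definition index_seq m : seq nat :=
  flatten [seq nseq (m j) (j : nat) | j <- rev (enum 'I_n)].

Lemma mindicesE m : mindices m = [seq x.+1 | x <- index_seq m].
Proof.
rewrite /mindices /index_seq map_flatten -map_comp; congr flatten.
by apply: eq_map => j /=; rewrite map_nseq.
Qed.

Lemma index_seq_lt m : all (gtn n) (index_seq m).
Proof.
apply/allP => x /flattenP[_ /mapP[j _ ->]]; rewrite mem_nseq => /andP[_ /eqP->].
exact: ltn_ord.
Qed.

Lemma mnm_of_index_seq m : mnm_of_seq (index_seq m) = m.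
Proof.
apply/mnmP => j; rewrite mnm_of_seqE /index_seq count_flatten sumnE -map_comp big_map.
rewrite big_rev /= big_enum /= (bigD1 j) //= count_nseq /= eqxx mul1n.
rewrite big1 ?addn0 // => i ne; rewrite count_nseq /=.
by case: (_ =P (j : nat)) => [/val_inj E|//]; rewrite E eqxx in ne.
Qed.

Lemma size_index_seq m : size (index_seq m) = mdeg m.
Proof. by rewrite -{2}(mnm_of_index_seq m) mdeg_mnm_of_seq // index_seq_lt. Qed.

Lemma index_seq_wdesc m : wdesc (index_seq m).
Proof.
rewrite /index_seq; have : sorted (fun x y : 'I_n => (y < x)%N) (rev (enum 'I_n)).
  rewrite rev_sorted; have := iota_ltn_sorted 0 n.
  by rewrite -val_enum_ord sorted_map.
have tr : transitive (fun x y : nat => (y <= x)%N) by move=> x y z H1 H2; apply: leq_trans H2 H1.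
elim: (rev _) => //= j r IH H; rewrite /wdesc sorted_pairwise // pairwise_cat -!sorted_pairwise //.
have Hf := IH (path_sorted H); rewrite /wdesc in Hf; rewrite Hf andbT.
apply/andP; split; last first.
  by case: (m j) => //= c; elim: c => //= c ->; rewrite leqnn.
apply/allrelP => x y; rewrite mem_nseq => /andP[_ /eqP->].
case/flattenP => _ /mapP[l lr ->]; rewrite mem_nseq => /andP[_ /eqP->].
apply: ltnW; move: H; rewrite path_sortedE; last by move=> a b c H1 H2; apply: ltn_trans H2 H1.
by case/andP=> /allP/(_ l lr).
Qed.

Lemma index_seq_mnm_of s : all (gtn n) s -> wdesc s -> index_seq (mnm_of_seq s) = s.
Proof.
move=> lt_s ds; apply: wdesc_eq (index_seq_wdesc _) ds _.
apply: mnm_of_seq_inj => //; first exact: index_seq_lt.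
exact: mnm_of_index_seq.
Qed.

Definition desc_enum F : seq nat := rev [seq val x | x <- enum F].

Lemma mem_desc_enum F (x : 'I_n) : ((x : nat) \in desc_enum F) = (x \in F).
Proof. by rewrite mem_rev mem_map ?mem_enum //; apply: val_inj. Qed.

Lemma size_desc_enum F : size (desc_enum F) = #|F|.
Proof. by rewrite size_rev size_map -cardE. Qed.

Lemma desc_enum_lt F : all (gtn n) (desc_enum F).
Proof. by rewrite all_rev; apply/allP => _ /mapP[x _ ->]; apply: ltn_ord. Qed.

Lemma desc_enum_desc F : desc (desc_enum F).
Proof.
rewrite /desc /desc_enum rev_sorted; have := iota_ltn_sorted 0 n.
rewrite -val_enum_ord !sorted_map => H.
apply: (subseq_sorted _ _ H); first by move=> x y z; apply: ltn_trans.
by rewrite /enum_mem; apply: filter_subseq.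
Qed.

Lemma desc_enumP F s : desc s -> (forall x, x \in s -> exists2 y : 'I_n, y \in F & x = y) ->
  (forall y : 'I_n, y \in F -> (y : nat) \in s) -> desc_enum F = s.
Proof.
move=> ds H1 H2; apply: desc_eq (desc_enum_desc F) ds _ => x; apply/idP/idP.
  by move=> Hx; have /= lt_x := allP (desc_enum_lt F) _ Hx;
     apply: (H2 (Ordinal lt_x)); rewrite -mem_desc_enum.
by case/H1 => y yF ->; rewrite mem_desc_enum.
Qed.

Lemma desc_enum_inj : injective desc_enum.
Proof. by move=> F F' E; apply/setP => x; rewrite -!mem_desc_enum E. Qed.

(* The monomial whose image under Phi has support F. *)
Definition mnm_of_set F := mnm_of_seq (shift_up (desc_enum F)).

Lemma shift_up_lt s : desc s -> all (gtn n) s -> all (gtn n) (shift_up s).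
Proof.
move=> ds lt_s; apply/(all_nthP 0) => a; rewrite size_shift_up => lt_a.
rewrite nth_shift_up //=; have := desc_nth ds (leq0n a) lt_a.
have /= := all_nthP 0 lt_s 0 (leq_ltn_trans (leq0n a) lt_a); lia.
Qed.

Lemma index_seq_mnm_of_set F : index_seq (mnm_of_set F) = shift_up (desc_enum F).
Proof.
apply: index_seq_mnm_of; last exact/shift_up_wdesc/desc_enum_desc.
by apply: shift_up_lt; [apply: desc_enum_desc | apply: desc_enum_lt].
Qed.

Lemma mnm_of_set_inj : injective mnm_of_set.
Proof.
move=> F F' E; apply: desc_enum_inj; rewrite -[LHS]shift_upK -[RHS]shift_upK.
by rewrite -!index_seq_mnm_of_set E.
Qed.

Lemma Phi_positive m : (forall z, z \in Phi m -> (1 <= z)%R) <->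
  forall a, (a < size (index_seq m))%N -> (a <= nth 0 (index_seq m) a)%N.
Proof.
have sz : size (mindices m) = size (index_seq m) by rewrite mindicesE size_map.
split=> [H a lt_a|H z /mapP[a]].
  have /H : ((nth 0 (mindices m) a)%:Z - a%:Z)%R \in Phi m.
    by apply/mapP; exists a; rewrite // mem_iota sz.
  by rewrite mindicesE (nth_map 0) //; lia.
rewrite mem_iota sz /= => lt_a ->; rewrite mindicesE (nth_map 0) //.
by have := H _ lt_a; lia.
Qed.

Lemma mem_Phi_supp m (j : 'I_n) :
    (forall a, (a < size (index_seq m))%N -> (a <= nth 0 (index_seq m) a)%N) ->
  (j \in Phi_supp m) = ((j : nat) \in shift_down (index_seq m)).
Proof.
move=> H; rewrite inE; have sz : size (mindices m) = size (index_seq m).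
  by rewrite mindicesE size_map.
apply/mapP/mapP => -[a]; rewrite mem_iota /= ?sz => lt_a E; exists a;
  rewrite ?mem_iota ?sz //; move: E; rewrite mindicesE (nth_map 0) //;
  have := H _ lt_a; lia.
Qed.

Lemma mnm_of_Phi_supp m : (forall z, z \in Phi m -> (1 <= z)%R) ->
  mnm_of_set (Phi_supp m) = m.
Proof.
move=> /Phi_positive H; rewrite /mnm_of_set.
have -> : desc_enum (Phi_supp m) = shift_down (index_seq m).
  apply: desc_enumP => [|x Hx|y].
  - by apply: shift_down_desc => //; apply: index_seq_wdesc.
  - have lt_x : (x < n)%N.
      case/mapP: Hx => a; rewrite mem_iota /= => lt_a ->.
      by have /= := all_nthP 0 (index_seq_lt m) a lt_a; lia.
    by exists (Ordinal lt_x); rewrite ?mem_Phi_supp.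
  - by rewrite mem_Phi_supp.
by rewrite shift_downK // mnm_of_index_seq.
Qed.

Lemma Phi_supp_mnm_of_set F :
  (forall z, z \in Phi (mnm_of_set F) -> (1 <= z)%R) /\ Phi_supp (mnm_of_set F) = F.
Proof.
have H a : (a < size (index_seq (mnm_of_set F)))%N ->
    (a <= nth 0 (index_seq (mnm_of_set F)) a)%N.
  rewrite index_seq_mnm_of_set size_shift_up => lt_a.
  by rewrite nth_shift_up // leq_addl.
split; first exact/Phi_positive.
apply/setP => j; rewrite mem_Phi_supp // index_seq_mnm_of_set shift_upK.
exact: mem_desc_enum.
Qed.

(** Phi is a bijection from the monomials with positive indices in Phi to sets, with inverse
    [mnm_of_set]; the existential over monomials disappears. *)
Lemma symmetric_shiftingE (k : fieldType) Gamma F :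
  F \in symmetric_shifting k Gamma <-> Bset (stanley_reisner k Gamma) (mnm_of_set F).
Proof.
rewrite inE; split=> [/asboolP[m [Bm Hm ->]]|BF].
  by rewrite mnm_of_Phi_supp.
by apply/asboolP; exists (mnm_of_set F); have [H1 H2] := Phi_supp_mnm_of_set F.
Qed.

End MonomialsOfLists.

(** * Torsion monomials correspond to facets *)

Section Facets.

Variable n : nat.
Local Open Scope nat_scope.
Implicit Types (m a : 'X_{1..n}) (F : {set 'I_n}) (l v : 'I_n).
Variable G : 'X_{1..n} -> Prop.
Hypothesis Gup : forall a m, G m -> G (a + m)%MM.
Hypothesis Gbound : multiplication_kernel_bound G.
Hypothesis Gborel : borel_stable G.

(** Strong stability raises one entry at a time, and surplus entries of [t] are a further factor;
    the prefix [q] in the proof holds the entries already raised. *)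
Lemma borel_dominance (s t : seq nat) : all (gtn n) s -> all (gtn n) t ->
    size s <= size t -> (forall a : nat, a < size s -> nth 0 s a <= nth 0 t a) ->
  G (mnm_of_seq n s) -> G (mnm_of_seq n t).
Proof.
have step q x y : x <= y -> y < n -> G (mnm_of_seq n (x :: q)) -> G (mnm_of_seq n (y :: q)).
  rewrite leq_eqVlt => /orP[/eqP-> //|lt_xy] lt_y.
  have lt_x := ltn_trans lt_xy lt_y; pose vx := Ordinal lt_x; pose vy := Ordinal lt_y.
  rewrite (mnm_of_cons vx) (mnm_of_cons vy) => Gx.
  have := @Gborel _ vx vy lt_xy _ Gx; rewrite mnmDE mnm1E eqxx => /(_ isT).
  by rewrite addmC [(U_(vx) + _)%MM]addmC addmK addmC [(_ + U_(vy))%MM]addmC addmC.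
suff gen q : all (gtn n) s -> all (gtn n) t -> size s <= size t ->
    (forall a : nat, a < size s -> nth 0 s a <= nth 0 t a) ->
    G (mnm_of_seq n (q ++ s)) -> G (mnm_of_seq n (q ++ t)) by apply: (gen [::]).
elim: s t q => [|x s IH] [|y t] q //.
- by move=> _ _ _ _; rewrite cats0 mnm_of_cat addmC; apply: Gup.
move=> /= /andP[lt_x ls] /andP[lt_y lt] szst H Gx.
have E z p : mnm_of_seq n (q ++ z :: p) = mnm_of_seq n (z :: q ++ p).
  by apply/mnmP => j; rewrite !mnm_of_seqE /= !count_cat /= addnCA.
rewrite E; apply: (IH t (y :: q)) => // [a lt_a|]; first exact: (H a.+1).
have le_xy : x <= y := H 0 isT.
by apply: (step _ _ _ le_xy lt_y); rewrite -E.
Qed.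

Lemma mnm_of_set_dominance F F' :
    (forall c, #|[set x in F | c <= x]| <= #|[set x in F' | c <= x]|) ->
  G (mnm_of_set F) -> G (mnm_of_set F').
Proof.
move=> H; have cE (E : {set 'I_n}) c : count (leq c) (desc_enum E) = #|[set x in E | c <= x]|.
  rewrite /desc_enum count_rev count_map -size_filter cardE /enum_mem.
  rewrite -filter_predI; congr size; apply: eq_filter => x.
  by rewrite /= !inE andbC.
have dE (E : {set 'I_n}) := desc_enum_desc E.
have [sz le_nth] := desc_dominance (dE F) (dE F') (fun c => etrans (congr2 leq (cE F c) (cE F' c)) (H c)).
have lt_up (E : {set 'I_n}) : all (gtn n) (shift_up (desc_enum E)).
  by apply: shift_up_lt; [apply: dE | apply: desc_enum_lt].
apply: borel_dominance => //; rewrite !size_shift_up // => a lt_a.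
rewrite !nth_shift_up ?leq_add2r ?le_nth //; exact: leq_trans lt_a sz.
Qed.

Variables (i r : nat).
Hypotheses (le_in : i <= n) (le_ri : r <= i).

(** The leading monomials of degree r in the saturation of J_i but not in J_i, which b_{i,r}
    counts. *)
Definition torsion_mnm m := [/\ mdeg m = r, ~ Jlm G i m &
  forall v, v = i :> nat -> exists c, Jlm G i (m + U_(v) *+ c)%MM].

Lemma mnm_of_nseq_supp c x l : mnm_of_seq n (nseq c x) l != 0 -> l = x :> nat.
Proof. by rewrite mnm_of_seqE count_nseq /=; case: (x =P l). Qed.

(** The kernel bound eliminates [a] and [c]: multiplication by y_i^(i-r) brings the degree to i,
    where powers of y_1, ..., y_i cancel, and y_{i+1}^(i-r+1) brings it to i + 1, where those of
    y_{i+1} cancel too. *)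
Lemma torsion_mnmP m : mdeg m = r -> torsion_mnm m <->
  [/\ supp_ge i m, ~ G (m + mnm_of_seq n (nseq (i - r) i.-1))%MM &
      i < n -> G (m + mnm_of_seq n (nseq (i - r).+1 i))%MM].
Proof.
move=> dm; have lt_pred : all (gtn n) (nseq (i - r) i.-1).
  by apply/allP => x; rewrite mem_nseq => /andP[H /eqP->] /=; lia.
split=> [[_ nJ tors]|[ms nG1 G2]].
  have ms : supp_ge i m.
    by move=> l li; apply: contrapT => ml; apply: nJ; left; exists l.
  split=> // [G1|lt_in].
    apply: nJ; right; exists (mnm_of_seq n (nseq (i - r) i.-1)); split=> // l il.
    apply/eqP/negPn/negP => nz; have E := mnm_of_nseq_supp nz.
    by move: nz; rewrite mnm_of_seqE count_nseq; lia.
  pose v := Ordinal lt_in; have [c [[l [li]]|[a [sa Ga]]]] := tors v erefl.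
    rewrite mnmDE mulmnE mnm1E ms //; case: (v =P l) => [E|//].
    by rewrite -E ltnn in li.
  rewrite (mnm_of_nseq _ v).
  apply: (kernel_bound_iter Gbound (a := (U_(v) *+ c + a)%MM)); last first.
  - have -> : (m + U_(v) *+ (i - r).+1 + (U_(v) *+ c + a) =
        U_(v) *+ (i - r).+1 + (m + U_(v) *+ c + a))%MM.
      by rewrite [(m + U_(v) *+ _)%MM]addmC -!addmA.
    exact: Gup.
  - move=> l l'; rewrite !mnmDE !mulmnE !mnm1E => Hl Hl'.
    have il : i <= l.
      rewrite leqNgt; apply/negP => li; move: Hl; rewrite ms // add0n.
      by case: (v =P l) => [E|//]; rewrite -E ltnn in li.
    apply: leq_trans il; rewrite leqNgt; apply/negP => il'.
    move: Hl'; rewrite sa ?(ltnW il') // addn0.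
    by case: (v =P l') => [E|//]; rewrite -E ltnn in il'.
  - move=> l; rewrite !mnmDE !mulmnE !mnm1E mdegD mdegMn mdeg1 mul1n dm => Hl.
    suff : l <= i by lia.
    rewrite leqNgt; apply/negP => il; move: Hl; rewrite sa ?(ltnW il) // addn0.
    by case: (v =P l) => [E|//]; rewrite -E ltnn in il.
split=> // [[[l [li ml]]|[a [sa Ga]]]|v vi]; first by apply: ml; apply: ms.
  apply: nG1; apply: (kernel_bound_iter Gbound (a := a)).
  - move=> l al; rewrite mdegD dm mdeg_mnm_of_seq // size_nseq subnKC //.
    by rewrite ltnNge; apply: contra al => il; rewrite sa.
  - move=> l l' Hl al'; have lt_l' : l' < i.
      by rewrite ltnNge; apply: contra al' => il; rewrite sa.
    case: (ltnP l i) => [li|]; last by apply: leq_trans; apply: ltnW.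
    move: Hl; rewrite mnmDE ms // add0n => /mnm_of_nseq_supp ->.
    by rewrite -ltnS prednK // (leq_trans _ lt_l').
  - by rewrite -addmA [(mnm_of_seq _ _ + a)%MM]addmC addmA addmC; apply: Gup.
have lt_in : i < n by rewrite -vi.
exists (i - r).+1; right; exists 0%MM; split; first by move=> l _; rewrite mnm0E.
by rewrite addm0 -mnm_of_nseq vi; apply: G2.
Qed.

(* F is the support of Phi(facet_mnm F * y_i^(i-r)). *)
Definition facet_mnm F : 'X_{1..n} := mnm_of_seq n (shift_up (take r (desc_enum F))).

(** In 0-based indices [l = i - r] is the vertex i - r + 1; the last clause is vacuous if i - r =
    n. *)
Definition facet_shape F := [/\ #|F| = i, forall l, l < i - r -> l \in F &
  forall l, l = i - r :> nat -> l \notin F].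

Lemma facet_desc_enum F : facet_shape F -> exists L, [/\ size L = r, desc L,
  all (leq (i - r).+1) L & desc_enum F = L ++ rev (iota 0 (i - r))].
Proof.
move=> [cF lowF gapF]; pose L := [seq x <- desc_enum F | i - r < x].
have dF := desc_enum_desc F; have dL : desc L.
  by apply: subseq_sorted dF; [move=> x y z H1 H2; apply: ltn_trans H2 H1 | apply: filter_subseq].
have aL : all (leq (i - r).+1) L by apply: filter_all.
have E : desc_enum F = L ++ rev (iota 0 (i - r)).
  apply: desc_eq => //.
    apply: desc_cat_iota => //; apply: sub_all aL => x; exact: ltnW.
  move=> x; rewrite mem_cat mem_filter mem_rev_iota.
  case: (ltngtP x (i - r)) => [lt_x|_|xE]; rewrite ?orbF //; last first.
    apply/negP => Hx; have /= lt_x := allP (desc_enum_lt F) _ Hx.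
    move: Hx; rewrite -[x]/(nat_of_ord (Ordinal lt_x)) mem_desc_enum.
    by apply/negP; apply: gapF.
  have lt_xn : x < n by lia.
  by rewrite -[x]/(nat_of_ord (Ordinal lt_xn)) mem_desc_enum lowF.
exists L; split=> //; have := congr1 size E.
by rewrite size_desc_enum cF size_cat size_rev size_iota; lia.
Qed.

Lemma facet_mnmE F L : size L = r -> desc_enum F = L ++ rev (iota 0 (i - r)) ->
  facet_mnm F = mnm_of_seq n (shift_up L) /\
  mnm_of_set F = (facet_mnm F + mnm_of_seq n (nseq (i - r) i.-1))%MM.
Proof.
move=> sL E; have F1 : facet_mnm F = mnm_of_seq n (shift_up L).
  by rewrite /facet_mnm E take_size_cat.
split=> //; rewrite F1 /mnm_of_set E shift_up_cat_iota mnm_of_cat sL subnKC //.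
Qed.

(** Filling the gap lengthens the final block by one vertex, so the shift levels it one step higher,
    at y_{i+1}. *)
Lemma add_gap_mnm F L v : v = i - r :> nat -> size L = r -> desc L ->
    all (leq (i - r).+1) L -> desc_enum F = L ++ rev (iota 0 (i - r)) ->
  mnm_of_set (v |: F) = (facet_mnm F + mnm_of_seq n (nseq (i - r).+1 i))%MM.
Proof.
move=> vE sL dL aL E; have [-> _] := facet_mnmE sL E; rewrite /mnm_of_set.
have -> : desc_enum (v |: F) = L ++ rev (iota 0 (i - r).+1).
  apply: desc_enumP; first exact: desc_cat_iota.
    move=> x; rewrite mem_cat mem_rev_iota ltnS => H.
    have [xv|nxv] := eqVneq x (v : nat); first by exists v; rewrite // setU11.
    have : x \in desc_enum F.
      rewrite E mem_cat mem_rev_iota; move: H; rewrite leq_eqVlt -vE.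
      by rewrite (negPf nxv).
    move=> Hx; have /= lt_x := allP (desc_enum_lt F) _ Hx.
    by exists (Ordinal lt_x); rewrite // in_setU1 -mem_desc_enum Hx orbT.
  move=> y; rewrite in_setU1 mem_cat mem_rev_iota ltnS => /orP[/eqP->|].
    by rewrite vE leqnn orbT.
  rewrite -mem_desc_enum E mem_cat mem_rev_iota => /orP[->//|/ltnW->].
  by rewrite orbT.
rewrite shift_up_cat_iota mnm_of_cat sL; congr (_ + mnm_of_seq n (nseq _ _))%MM; lia.
Qed.

Lemma facet_mnm_supp F L : size L = r -> desc L -> all (leq (i - r).+1) L ->
  all (leq i) (shift_up L).
Proof.
move=> sL dL aL; apply/(all_nthP 0) => a; rewrite size_shift_up => lt_a.
rewrite nth_shift_up //; have lt_r : r.-1 < size L by rewrite sL; lia.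
have le_a : a <= r.-1 by lia.
have := desc_nth dL le_a lt_r; have := all_nthP 0 aL _ lt_r; rewrite /=; lia.
Qed.

Lemma supp_ge_mnm_of_seq s : all (leq i) s -> supp_ge i (mnm_of_seq n s).
Proof.
move=> /allP H l li; rewrite mnm_of_seqE; apply/eqP; rewrite -leqn0 leqNgt -has_count.
by apply/hasP => -[x /H ix /eqP E]; rewrite E leqNgt li in ix.
Qed.

Lemma desc_enum_size_lt s : desc s -> all (gtn n) s -> exists F, desc_enum F = s.
Proof.
move=> ds /allP ls; exists [set x : 'I_n | (x : nat) \in s]; apply: desc_enumP => //.
  by move=> x xs; have /= lt_x := ls _ xs; exists (Ordinal lt_x); rewrite ?inE.
by move=> y; rewrite inE.
Qed.

Lemma shape_of_desc_enum F L : size L = r -> all (leq (i - r).+1) L ->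
  desc_enum F = L ++ rev (iota 0 (i - r)) -> facet_shape F.
Proof.
move=> sL /allP aL E; split.
- by rewrite -size_desc_enum E size_cat sL size_rev size_iota subnKC.
- by move=> l lt_l; rewrite -mem_desc_enum E mem_cat mem_rev_iota lt_l orbT.
- move=> l lE; rewrite -mem_desc_enum E mem_cat mem_rev_iota lE ltnn orbF.
  by apply/negP => /aL /=; rewrite ltnn.
Qed.

Variable Delta : {set {set 'I_n}}.
Hypothesis DeltaE : forall F, F \in Delta <-> ~ G (mnm_of_set F).

(** Maximality is applied to [F] with the vertex i - r + 1 added, whose monomial is that of the
    condition at y_{i+1}. *)
Lemma facet_torsion F : F \in facets Delta -> facet_shape F ->
  mdeg (facet_mnm F) = r /\ torsion_mnm (facet_mnm F).
Proof.
rewrite inE => /maxsetP[FD maxF] sF; have [L [sL dL aL E]] := facet_desc_enum sF.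
have [F1 F2] := facet_mnmE sL E.
have ltL : all (gtn n) (shift_up L).
  apply: shift_up_lt => //; have := desc_enum_lt F; rewrite E all_cat.
  by case/andP.
have dF : mdeg (facet_mnm F) = r by rewrite F1 mdeg_mnm_of_seq // size_shift_up.
split=> //; apply/torsion_mnmP => //; split.
- by rewrite F1; apply/supp_ge_mnm_of_seq/(facet_mnm_supp F).
- by rewrite -F2; apply/DeltaE.
- move=> lt_in; have lt_gap : i - r < n by lia.
  pose v := Ordinal lt_gap; rewrite -(add_gap_mnm (v := v) _ sL dL aL E) //.
  apply: contrapT => /DeltaE vD; have := maxF _ vD (subsetUr _ _) => vF.
  have [_ _ /(_ v erefl)] := sF; by rewrite -{1}vF setU11.
Qed.

(** The condition at y_{i+1} excludes directly only the extension of [F] by the gap vertex. Any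
    other extension uses a larger vertex, and strong stability carries membership in [G] over to
    it. *)
Lemma torsion_facet m : torsion_mnm m ->
  exists2 F, F \in facets Delta /\ facet_shape F & facet_mnm F = m.
Proof.
move=> tm; have [dm _ _] := tm; have [ms nG1 G2] := iffLR (torsion_mnmP dm) tm.
pose s := index_seq m; have ws : wdesc s := index_seq_wdesc m.
have ss : size s = r by rewrite size_index_seq.
have ls : all (gtn n) s := index_seq_lt m.
have is_ (a : nat) : a < r -> i <= nth 0 s a.
  move=> lt_a; have Hs : nth 0 s a \in s by apply: mem_nth; rewrite ss.
  have /= lt_n := allP ls _ Hs; rewrite leqNgt; apply/negP => lt_i.
  have := ms (Ordinal lt_n) lt_i; rewrite -(mnm_of_index_seq m) mnm_of_seqE => /eqP.
  by rewrite -leqn0 leqNgt -has_count has_pred1 Hs.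
have le_s (a : nat) : a < size s -> a <= nth 0 s a.
  by rewrite ss => lt_a; have := is_ a lt_a; lia.
pose L := shift_down s; have dL : desc L by apply: shift_down_desc.
have sL : size L = r by rewrite size_shift_down.
have aL : all (leq (i - r).+1) L.
  apply/(all_nthP 0) => a; rewrite sL => lt_a /=; rewrite nth_shift_down ?ss //.
  by have := is_ a lt_a; lia.
have lL : all (gtn n) L.
  apply/(all_nthP 0) => a; rewrite sL => lt_a /=; rewrite nth_shift_down ?ss //.
  by have /= := all_nthP 0 ls a; rewrite ss => /(_ lt_a); lia.
have [F E] : exists F, desc_enum F = L ++ rev (iota 0 (i - r)).
  apply: desc_enum_size_lt.
    apply: desc_cat_iota => //; apply: sub_all aL => x; exact: ltnW.
  rewrite all_cat lL /= all_rev; apply/allP => x; rewrite mem_iota /=; lia.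
have sF := shape_of_desc_enum sL aL E.
have [F1 F2] := facet_mnmE sL E.
have Fm : facet_mnm F = m by rewrite F1 shift_downK // mnm_of_index_seq.
exists F => //; split=> //; rewrite inE; apply/maxsetP; split.
  by apply/DeltaE; rewrite F2 Fm.
move=> B BD sFB; apply/eqP; rewrite eq_sym eqEsubset sFB /=.
apply/negPn/negP => /subsetPn[v vB vF]; have [cF lowF gapF] := sF.
have lt_in : i < n.
  rewrite -cF; apply: leq_trans (leq_card_face B).
  by apply: proper_card; apply/properP; split=> //; exists v.
have lt_gap : i - r < n by lia.
have le_v : i - r <= v by rewrite leqNgt; apply: contra vF => /lowF.
pose w := Ordinal lt_gap; have := iffLR (DeltaE B) BD; apply.
have := G2 lt_in; rewrite -Fm -(add_gap_mnm (v := w) _ sL dL aL E) //.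
(* Above the gap [w |: F] counts like [F]; from the gap downwards [w] is matched by [v], which lies
   at or above the gap. *)
apply: mnm_of_set_dominance => c; have [le_c|lt_c] := leqP c (i - r).
  apply: (@leq_trans #|v |: [set x in F | c <= x]|).
    rewrite cardsU1 inE negb_and vF /= add1n.
    have -> : [set x in w |: F | c <= x] = w |: [set x in F | c <= x].
      by apply/setP => x; rewrite !inE; case: eqP => [->|]; rewrite ?le_c.
    by rewrite cardsU1 -add1n leq_add2r leq_b1.
  apply/subset_leq_card/fintype.subsetP => x; rewrite !inE => /orP[/eqP->|/andP[xF ->]].
    by rewrite vB (leq_trans le_c).
  by rewrite (fintype.subsetP sFB).
apply/subset_leq_card/fintype.subsetP => x; rewrite !inE => /andP[/orP[/eqP->|xF] cx].
  by rewrite leqNgt lt_c in cx.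
by rewrite cx (fintype.subsetP sFB).
Qed.

Lemma facet_mnm_inj F F' : facet_shape F -> facet_shape F' ->
  facet_mnm F = facet_mnm F' -> F = F'.
Proof.
move=> /facet_desc_enum[L [sL _ _ E]] /facet_desc_enum[L' [sL' _ _ E']] EF.
have [_ H] := facet_mnmE sL E; have [_ H'] := facet_mnmE sL' E'.
by apply: mnm_of_set_inj; rewrite H H' EF.
Qed.

End Facets.

Theorem theorem4p1 (k : fieldType) (hk : [pchar k] =i pred0) (n : nat)
    (Gamma : {set {set 'I_n}}) (hGamma : simplicial_complex Gamma)
    (U : 'M[k]_n -> Prop) (hU : generic_locus (stanley_reisner k Gamma) U)
    (u : 'M[k]_n) (hu : U u) (i r : nat) (hi : (i <= n)%N) (hr : (r <= n)%N) :
  is_iterated_betti (stanley_reisner k Gamma) u i r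
    (if (r <= i)%N then
       #|[set F in facets (symmetric_shifting k Gamma) |
            [&& #|F| == i,
                [forall j : 'I_n, (j < i - r)%N ==> (j \in F)]
              & [forall j : 'I_n, (j == i - r :> nat)%N ==> (j \notin F)]]]|
     else 0%N).
Proof.
set I := stanley_reisner k Gamma.
have idI : is_ideal I := stanley_reisner_ideal k Gamma.
have hI : hom_closed I := stanley_reisner_hom hGamma.
have uu := generic_locus_unit hU hu.
have iduI := ideal_imageP uu idI; have huI := ideal_image_hom (u := u) hI.
pose G := lm (ideal_image u I).
have Gup a m : G m -> G (a + m)%MM by apply: lm_up.
have Gbound : multiplication_kernel_bound G := kernel_bound_generic hk hGamma hU hu.
have Gborel : borel_stable G := borel_stable_generic hk idI hI hU hu.
have lmG m : lm (ideal_image u I) m <-> G m by [].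
have [idJ hJ _ lmJ] := Jideal_lm Gbound iduI huI lmG hi.
have lmK m := saturation_lm Gbound iduI huI lmG m hi.
have KE := saturation_Jideal Gbound hi (Jideal_lm Gbound iduI huI lmG hi).
have idK : is_ideal (saturation (Jideal I u i)).
  by rewrite KE; apply: colon_powerP.
have hK : hom_closed (saturation (Jideal I u i)).
  by rewrite KE; apply: colon_power_hom.
have sJK f : Jideal I u i f -> saturation (Jideal I u i) f.
  by rewrite KE; apply: colon_power_sub.
have torsE m : mdeg m = r -> (lm (saturation (Jideal I u i)) m /\ ~ lm (Jideal I u i) m) <->
    torsion_mnm G i r m.
  by move=> dm; split=> [[/lmK H1 nJ]|[_ nJ H]]; split=> //; rewrite ?lmK // => /lmJ.
rewrite /is_iterated_betti; case: ifP => [le_ri|/negbT]; last first.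
  (* For r > i the kernel bound leaves no torsion in degree r, and the empty family is a basis; i <
     n here because i < r <= n. *)
  rewrite -ltnNge => lt_ir.
  suff : quot_dim (fun f => f \is r.-homog /\ saturation (Jideal I u i) f)
      (Jideal I u i) #|(set0 : {set {set 'I_n}})| by rewrite cards0.
  apply: (quot_dim_lm (mu := fun=> 0%MM)) => //; first by move=> F; rewrite inE.
    by move=> F; rewrite inE.
  move=> m dm lK nJ; exfalso; have [//|_ nJ' H] := iffLR (torsE m dm).
  have [lt_in|le_ni] := ltnP i n; last by move: lt_ir; rewrite ltnNge (leq_trans hr).
  have [c Jc] := H (Ordinal lt_in) erefl; apply: nJ'.
  by apply: (Jlm_kernel_bound Gbound (v := Ordinal lt_in) _ Jc); rewrite dm.
have DeltaE F : F \in symmetric_shifting k Gamma <-> ~ G (mnm_of_set F).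
  by rewrite symmetric_shiftingE /Bset (Gin_lm hk _ idI hU hu).
set A := [set F in _ | _].
have AP F : F \in A <-> F \in facets (symmetric_shifting k Gamma) /\ facet_shape i r F.
  rewrite !in_set; split=> [/andP[-> /and3P[/eqP cF /forallP lowF /forallP gapF]]|].
    split=> //; split=> // l; first by apply/implyP.
    by move=> lE; apply: (implyP (gapF l)); rewrite lE.
  case=> -> [-> lowF gapF]; rewrite eqxx /=; apply/andP; split.
    by apply/forallP => l; apply/implyP => /lowF.
  by apply/forallP => l; apply/implyP => /eqP/gapF.
apply: (quot_dim_lm (mu := facet_mnm r)) => //.
- move=> F F' /AP[_ sF] /AP[_ sF']; exact: facet_mnm_inj sF sF'.
- move=> F /AP[fF sF]; have [dF tF] := facet_torsion Gup Gbound hi le_ri DeltaE fF sF.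
  by have [] := iffRL (torsE _ dF) tF.
- move=> m dm lK nJ; have tm := iffLR (torsE m dm) (conj lK nJ).
  have [F HF Fm] := torsion_facet Gup Gbound Gborel hi le_ri DeltaE tm.
  by exists F => //; apply/AP.
Qed.
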